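(* Let $P$ be a convex polytope in $\mathbb{R}^D$ with vertices in $\mathbb{Z}^D$, and let $s,d\in\mathbb{N}_0$ be given. There exists a constant $c_{s,d} > 0$ such that, for all sufficiently large $n$, at least $c_{s,d}\cdot 2^{|L(nP)|}$ of the subsets $A \subset L(nP)$ satisfy $$|(L(nP)+L(nP)) \setminus (A+A)| = s \quad\text{and}\quad |(L(nP)-L(nP)) \setminus (A-A)| \ge 2d.$$
   Context: For $S \subset \mathbb{R}^D$, $L(S) = S \cap \mathbb{Z}^D$ denotes the set of lattice points in $S$, and $nS$ denotes the dilation of $S$ by the factor $n$ about the origin. For finite sets $X,Y$, $X+Y=\{x+y: x\in X, y \in Y\}$ and $X-Y=\{x-y: x\in X,y\in Y\}$.
   Formalization: The polytope P is assumed to contain two distinct points; if P is a single point, L(nP)-L(nP)={0}, so at least 2d missing differences is impossible for d ≥ 1. *)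

(* Defs.v *)
From HB Require Import structures.
From mathcomp Require Import all_boot all_order all_algebra.
From mathcomp Require Import finmap.
From Stdlib Require Import Rdefinitions.
From mathcomp Require Import Rstruct.
Set Implicit Arguments. Unset Strict Implicit. Unset Printing Implicit Defensive.
Import Order.TTheory GRing.Theory Num.Theory.
Local Open Scope ring_scope.
Local Open Scope fset_scope.

Notation zpt D := 'rV[int]_D.

Definition toR (D : nat) (z : zpt D) : 'rV[R]_D := map_mx (fun k : int => k%:~R) z.

(* z lies in n * conv(V), i.e. in nP where P = conv(V) is the convex polytope
   with (integer) generating points V. *)
Definition in_dil (D : nat) (V : seq (zpt D)) (n : nat) (z : zpt D) : Prop :=
  exists lam : 'I_(size V) -> R,
    (forall i, 0 <= lam i) /\ (\sum_i lam i = 1) /\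
    toR z = n%:R *: \sum_i lam i *: toR (nth 0 V i).

Definition sumset (D : nat) (X Y : {fset zpt D}) : {fset zpt D} :=
  [fset GRing.add x y | x : zpt D in X, y : zpt D in Y].
Definition diffset (D : nat) (X Y : {fset zpt D}) : {fset zpt D} :=
  [fset GRing.add x (GRing.opp y) | x : zpt D in X, y : zpt D in Y].

(* Main.v *)
(* Choose an additive functional [f] with a unique maximum [u] and a unique
   minimum [v] on [V].  Near [n u] and [n v] the set [Ln] looks like the lattice
   points [K1], [K2] of two pointed cones, graded by [f].  There are fixed
   patterns [L] in [K1] and [U] in [K2], full at large height, such that [L + L]
   misses exactly [s] points of [K1], [U + U] misses nothing, and [L + U] misses
   [d] multiples of [u - v].  Prescribe [A] to follow [L] near [n u], [U] near
   [n v] and to be full near the other points of [n V]: this fixes boundedly many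
   elements of [A].  A sum at distance [r] from all the points of [2n V] has at
   least const * r representations along some direction [v_a - v_b], so it is
   missed with probability at most [theta ^ r]; the number of such sums grows
   only polynomially in [r], and a union bound concludes. *)
Require Import Defs.
From HB Require Import structures.
From mathcomp Require Import all_boot all_order all_algebra.
From mathcomp Require Import finmap.
From Stdlib Require Import Rdefinitions.
From mathcomp Require Import Rstruct.
From mathcomp Require Import boolp zify lra.
Import Order.TTheory GRing.Theory Num.Theory.
(* [Rdefinitions] binds the keys N, Z and R to the scopes of Stdlib. *)
Delimit Scope nat_scope with N.
Delimit Scope int_scope with Z.
Delimit Scope ring_scope with R.
Local Open Scope ring_scope.


(** Abstracts the lattice points of a pointed cone graded by a height [f]. The field [gs_sub] stands
    in for finite generation: a high point can spare [q] copies of one element of small height. *)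
Record graded_semigroup {T : zmodType} (f : T -> int) (K : T -> Prop) (H : nat)
  : Prop := GradedSemigroup {
  gs0 : K 0;
  gsD : forall a b, K a -> K b -> K (a + b);
  gs_ge0 : forall a, K a -> 0 <= f a;
  gs_eq0 : forall a, K a -> f a = 0 -> a = 0;
  gs_fin : forall h : nat, exists X : seq T, forall a, K a -> f a <= h%:Z -> a \in X;
  gs_sub : forall (q : nat) a, (0 < q)%N -> K a -> (q * H)%N%:Z < f a ->
    exists g, [/\ K g, 0 < f g, f g <= H%:Z & K (a - g *+ q)] }.

Arguments gs0 {T f K H} _.
Arguments gsD {T f K H} _ [a b] _ _.
Arguments gs_ge0 {T f K H} _ [a] _.
Arguments gs_eq0 {T f K H} _ [a] _ _.
Arguments gs_fin {T f K H} _ h.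
Arguments gs_sub {T f K H} _ [q a] _ _ _.

(** A failing value is congruent to [r] or to [c - r] modulo [q], and a window shorter than [q]
    holds at most one value of each class. *)
Lemma two_bad_residues (q r c x0 x1 x2 : int) : x1 < x0 -> x2 < x1 -> x0 - x2 < q ->
  exists2 x, x \in [:: x0; x1; x2] & ~~ (q %| x - r)%Z /\ ~~ (q %| c - x - r)%Z.
Proof.
move=> h1 h2 h3; have q0 : 0 < q by lia.
pose good x := ~~ (q %| x - r)%Z /\ ~~ (q %| c - x - r)%Z.
have small x y : (q %| x)%Z -> (q %| y)%Z -> 0 < x - y -> q <= x - y.
  move=> hx hy; have /dvdzP[z ->] := rpredB hx hy.
  by rewrite pmulr_lgt0 // => z0; apply: ler_peMl; [exact: ltW | lia].
have [g|n0] := pselect (good x0); first by exists x0; rewrite ?inE ?eqxx.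
have [g|n1] := pselect (good x1); first by exists x1; rewrite ?inE ?eqxx ?orbT.
have [g|n2] := pselect (good x2); first by exists x2; rewrite ?inE ?eqxx ?orbT.
have bad x : ~ good x -> (q %| x - r)%Z \/ (q %| c - x - r)%Z.
  rewrite /good; case: (_ %| x - _)%Z; first by left.
  by case: (_ %| _)%Z; [right | case].
case: (bad _ n0) (bad _ n1) (bad _ n2) => [y0|y0] [y1|y1] [y2|y2]; exfalso.
- by have := small _ _ y0 y1; lia.
- by have := small _ _ y0 y1; lia.
- by have := small _ _ y0 y2; lia.
- by have := small _ _ y2 y1; lia.
- by have := small _ _ y1 y2; lia.
- by have := small _ _ y2 y0; lia.
- by have := small _ _ y1 y0; lia.
- by have := small _ _ y1 y0; lia.
Qed.

(** * Fringe patterns in graded semigroups *)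

Section Fringe.
Context {T : zmodType} (f : {additive T -> int}).

Lemma gs_mulrn {K H} (gs : graded_semigroup f K H) a m : K a -> K (a *+ m).
Proof.
move=> Ka; elim: m => [|m IH]; first by rewrite mulr0n; exact: (gs0 gs).
by rewrite mulrS; apply: (gsD gs Ka IH).
Qed.

Lemma gs_divisor {K H} (gs : graded_semigroup f K H) (t : nat) a :
  (0 < H)%N -> K a -> t%:Z <= f a ->
  exists b, [/\ K b, K (a - b), t%:Z - H%:Z < f b & f b <= t%:Z].
Proof.
move=> H0; have [n] := ubnP `|f a|%N; elim: n a => // n IH a le Ka ta.
have [fat|fat] := lerP (f a) t%:Z.
  exists a; rewrite subrr; split=> //; [exact: (gs0 gs) | lia].
have [fH|fH] := lerP (f a) H%:Z.
  exists 0; rewrite raddf0 subr0; split=> //; [exact: (gs0 gs) | lia].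
have [|g [Kg g0 gH Kag]] := gs_sub gs (isT : (0 < 1)%N) Ka; first by rewrite mul1n.
rewrite mulr1n in Kag; have fag : f (a - g) = f a - f g by rewrite raddfB.
have [ft|ft] := ltrP (f (a - g)) t%:Z.
  exists (a - g); rewrite subKr; split=> //; lia.
have [|b [Kb Kagb b1 b2]] := IH (a - g) _ Kag ft; first by lia.
exists b; split=> //.
have -> : a - b = (a - g - b) + g by rewrite addrAC subrK.
exact: (gsD gs Kagb Kg).
Qed.

(* Greedily subtract q-fold multiples until the height drops below the bound. *)
Lemma gs_subq {K H} (gs : graded_semigroup f K H) (q h : nat) a :
  (0 < q)%N -> K a -> (q * H + h)%N%:Z < f a ->
  exists g, [/\ K g, (q%:Z %| f g)%Z, q%:Z <= f g, K (a - g) &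
                h%:Z < f (a - g) <= (q * H + h)%N%:Z].
Proof.
move=> q0; have [n] := ubnP `|f a|%N; elim: n a => // n IH a le Ka ta.
have [|g [Kg g0 gH Kag]] := gs_sub gs q0 Ka; first by lia.
have fag : f (a - g *+ q) = f a - f g *+ q by rewrite raddfB raddfMn.
have Kgq := gs_mulrn gs g q Kg.
have fgq : f (g *+ q) = q%:Z * f g by rewrite raddfMn /= -mulr_natl natz.
have hq : q%:Z <= q%:Z * f g by nia.
have hq2 : q%:Z * f g <= (q * H)%N%:Z by nia.
have fag2 : f (a - g *+ q) = f a - q%:Z * f g by rewrite raddfB fgq.
have [ft|ft] := lerP (f (a - g *+ q)) (q * H + h)%N%:Z.
  exists (g *+ q); split=> //; rewrite ?fgq ?dvdz_mulr //; lia.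
have [|b [Kb db qb Kagb hb]] := IH (a - g *+ q) _ Kag ft; first by lia.
exists (g *+ q + b); rewrite opprD addrA; split=> //.
- exact: (gsD gs Kgq Kb).
- by rewrite raddfD rpredD // fgq dvdz_mulr.
- by rewrite raddfD /=; lia.
Qed.

(** The multiples [w *+ 1], ..., [w *+ s] show that at least [s] nonzero points have height at most
    [s * f w], and [gs_fin] leaves finitely many such points; sorted by height, the first [s] form
    [R]. *)
Lemma gs_lowest {K H} (gs : graded_semigroup f K H) w s : K w -> 0 < f w ->
  exists R : seq T, [/\ uniq R, size R = s,
    forall a, a \in R -> [/\ K a, a != 0 & f a <= s%:Z * f w] &
    forall a b, a \in R -> K b -> b != 0 -> f b < f a -> b \in R].
Proof.
move=> Kw w0.
have [X hX] := gs_fin gs (s * `|f w|)%N.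
have hs : (s * `|f w|)%N%:Z = s%:Z * f w by lia.
pose P := fun a => `[< K a /\ a != 0 /\ f a <= s%:Z * f w >].
pose Y := [seq a <- undup X | P a].
have YP a : a \in Y <-> [/\ K a, a != 0 & f a <= s%:Z * f w].
  rewrite mem_filter mem_undup; split=> [/andP[/asboolP[? [? ?]] _]|[? ? ?]] //.
  by apply/andP; split; [apply/asboolP | apply: hX => //; rewrite hs].
have fwM j : f (w *+ j) = j%:Z * f w by rewrite raddfMn /= -mulr_natl natz.
have sY : (s <= size Y)%N.
  rewrite -[X in (X <= _)%N](size_iota 1) -(size_map (fun j => w *+ j)).
  apply: uniq_leq_size => [|a /mapP[j]].
    rewrite map_inj_in_uniq ?iota_uniq // => i j _ _ /(congr1 f).
    by rewrite !fwM => /(mulIf (lt0r_neq0 w0))[].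
  rewrite mem_iota => /andP[j1 j2] ->; apply/YP.
  split; first exact: (gs_mulrn gs w j Kw).
    by apply/eqP => /(congr1 f); rewrite fwM raddf0; nia.
  by rewrite fwM; nia.
pose le := fun a b => f a <= f b.
pose Z := sort le Y.
have memZ a : (a \in Z) = (a \in Y) by rewrite mem_sort.
have uZ : uniq Z by rewrite sort_uniq filter_uniq // undup_uniq.
have tr : transitive le by move=> a b c; apply: le_trans.
have sZ : sorted le Z by apply: sort_sorted => a b; apply: le_total.
exists (take s Z); split.
- by rewrite take_uniq.
- by rewrite size_takel // size_sort.
- by move=> a /mem_take; rewrite memZ => /YP.
- move=> a b aR Kb b0 ba.
  have /mem_take := aR; rewrite memZ => /YP[_ _ ha].
  have : b \in Z by rewrite memZ; apply/YP; split=> //; apply: (le_trans (ltW ba) ha).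
  rewrite -{1}(cat_take_drop s Z) mem_cat => /orP[//|bd].
  have := sZ; rewrite (sorted_pairwise tr) -(cat_take_drop s Z) pairwise_cat.
  case/andP=> /allrelP/(_ a b aR bd); rewrite /le => ab _.
  by have := lt_le_trans ba ab; rewrite ltxx.
Qed.

(** Lets [U + U] fill the cone although [U] skips a residue class. Divisors of [b] with heights in
    three consecutive windows of length [H] have distinct heights spread over less than [q], so
    [two_bad_residues] makes one splitting work. *)
Lemma gs_sum_coset_free {K H} (gs : graded_semigroup f K H) (q r t : nat) b :
  (0 < H)%N -> (3 * H < q)%N -> (3 * H <= r)%N -> (r < q)%N -> (3 * H < t)%N ->
  K b -> f b + (3 * H)%N%:Z < (2 * t)%N%:Z ->
  exists b1 b2, [/\ b = b1 + b2, K b1, K b2, f b1 < t%:Z & f b2 < t%:Z] /\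
    ~~ (q%:Z %| f b1 - r%:Z)%Z /\ ~~ (q%:Z %| f b2 - r%:Z)%Z.
Proof.
move=> H0 Hq Hr rq Ht Kb fb; have fb0 := gs_ge0 gs Kb.
have [/andP[fbt nfb]|hb] := boolP ((f b < t%:Z) && ~~ (q%:Z %| f b - r%:Z)%Z).
  exists b, 0; rewrite addr0 raddf0; split.
    split; [by [] | by [] | exact: (gs0 gs) | by [] | by rewrite ltz_nat; lia].
  split; first by [].
  rewrite sub0r dvdzE abszN /=; apply/negP => /dvdn_leq; lia.
(* The divisors will have height in the interval of length [3 * H] ending at [t0]. If [f b < t], the
   failed test makes [f b] congruent to [r], hence at least [r >= 3 * H], and [t0 = 3 * H] works.
   Otherwise [t0 = t - 1] leaves complements of height at most [t]. *)
have [t0 [t1 t2 t3 t4]] : exists t0 : nat,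
    [/\ (3 * H <= t0)%N, t0%:Z <= f b, (t0 < t)%N &
        f b - (t0%:Z - (3 * H)%N%:Z) <= t%:Z \/ f b < t%:Z].
  have [fbt|fbt] := ltrP (f b) t%:Z.
    exists (3 * H)%N; split=> //; last by right.
    move: hb; rewrite fbt /= negbK => /dvdzP[z hz].
    have z0 : 0 <= z by rewrite leNgt; apply/negP => z0; nia.
    have := mulr_ge0 z0 (ler0n _ q); rewrite natz; lia.
  by exists t.-1; split; try lia; left; lia.
have cand (i : nat) : (i < 3)%N -> exists b', [/\ K b', K (b - b'),
   t0%:Z - i.+1%:Z * H%:Z < f b' & f b' <= t0%:Z - i%:Z * H%:Z].
  move=> i3; have iH : (i * H <= t0)%N by nia.
  have [|b' [? ? ? ?]] := gs_divisor gs (t0 - i * H) b H0 Kb; first by lia.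
  by exists b'; split; [by [] | by [] | lia | lia].
have [b0 [K0 K0' l0 u0]] := cand 0%N isT.
have [b1 [K1 K1' l1 u1]] := cand 1%N isT.
have [b2 [K2 K2' l2 u2]] := cand 2%N isT.
pose good b' := ~~ (q%:Z %| f b' - r%:Z)%Z /\ ~~ (q%:Z %| f b - f b' - r%:Z)%Z.
suff [b' [Kb' Kb'' l u [g1 g2]]] : exists b', [/\ K b', K (b - b'),
    t0%:Z - 3%:Z * H%:Z < f b', f b' <= t0%:Z & good b'].
  have fbb : f (b - b') = f b - f b' by rewrite raddfB.
  exists b', (b - b'); rewrite fbb; split; last by split.
  split; [by rewrite [RHS]addrC subrK | by [] | by [] | lia | ].
  by clear -l u t1 t3 t4 t2; lia.
have [|||x] := two_bad_residues q%:Z r%:Z (f b) (f b0) (f b1) (f b2).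
- by clear -l0 u1; lia.
- by clear -l1 u2; lia.
- by clear -u0 l2 Hq; lia.
rewrite !inE => /or3P[] /eqP -> g.
- by exists b0; split=> //; clear -l0 u0; lia.
- by exists b1; split=> //; clear -l1 u1; lia.
- by exists b2; split=> //; clear -l2 u2; lia.
Qed.

(* [R] consists of the [s] lowest nonzero points of [K1], so that [K1 \ R] is still
   a semigroup.  With [p = f w] and a large modulus [q], [L] keeps the points of
   [K1 \ R] whose height is small, or divisible by [q], or at least [t']; [U] keeps
   those of [K2] whose height is below [t] and not [r] modulo [q], or at least
   [t'].  A multiple of [w] whose height is [r] modulo [q] and lies between [t]
   and [t'], far enough above [t], is then not in [L + U]. *)
Lemma fringe {K1 K2 H1 H2} w (s d : nat) :
  graded_semigroup f K1 H1 -> graded_semigroup f K2 H2 -> (0 < H2)%N ->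
  K1 w -> K2 w -> 0 < f w ->
  exists (t : nat) (R : seq T) (L U : T -> Prop) (cs : seq nat),
  [/\ [/\ uniq R, size R = s, {in R, forall a, K1 a},
       forall a b, L a -> L b -> a + b \notin R &
       forall a, K1 a -> a \notin R -> exists b c, [/\ L b, L c & a = b + c]],
     forall b, K2 b -> exists c e, [/\ U c, U e & b = c + e],
     (forall a, L a -> K1 a) /\ (forall a, K1 a -> a \notin R -> t%:Z <= f a -> L a),
     (forall b, U b -> K2 b) /\ (forall b, K2 b -> t%:Z <= f b -> U b) &
     [/\ uniq cs, size cs = d &
       {in cs, forall c a b, L a -> U b -> a + b <> w *+ c}]].
Proof.
move=> gs1 gs2 H20 K1w K2w w0.
have [R [uR sR RK Rlow]] := gs_lowest gs1 w s K1w w0.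
have [p hp] : exists p : nat, f w = p%:Z by exists `|f w|%N; lia.
rewrite hp in w0 RK; have p0 : (0 < p)%N by lia.
(* [r] is a multiple of [p], so the heights [r + q * p * i] belong to multiples of [w]; [q > s * p]
   keeps elements of height at least [q] out of [R]. *)
have [r [q [rE q0 rH rq sq]]] : exists r q : nat,
    [/\ r = 3 * H2 * p, 0 < q, 3 * H2 <= r, r < q & s * p < q]%N.
  exists (3 * H2 * p)%N, (3 * H2 * p + s * p + 1)%N; split; try lia.
  exact: leq_pmulr.
have [h hE] : exists h : nat, h = (q * H1 + s * p)%N by exists (q * H1 + s * p)%N.
have qp0 : (0 < q * p)%N by rewrite muln_gt0 q0.
have qqp : (q <= q * p)%N by rewrite leq_pmulr.
(* The second bound lets points of height below [t'] split into two of height below [t]. The fourth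
   puts the chosen multiples of [w] beyond any sum of heights at most [h] and below [t]. The
   equality leaves room for [d] such multiples below [t']. *)
have [t [t' [i0 [tt' t'2 tH thi it']]]] : exists t t' i0 : nat,
    [/\ t <= t', t' + 3 * H2 < 2 * t, 3 * H2 < t, t + h <= q * p * i0 &
        q * p * (i0 + d) = t']%N.
  have le x : (x <= q * p * x)%N by rewrite leq_pmull.
  exists (q * p * (h + d + 3 * H2 + 1))%N.
  exists (q * p * (h + d + 3 * H2 + 1 + h + d))%N, (h + d + 3 * H2 + 1 + h)%N.
  have := le h; have := le (3 * H2 + 1)%N; have := le (h + d + 3 * H2 + 1)%N.
  rewrite !mulnDr !muln1; clear; set x := (q * p)%N => *; split; lia.
pose L a := [/\ K1 a, a \notin R &
  [\/ f a <= h%:Z, (q%:Z %| f a)%Z | t'%:Z <= f a]].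
pose U b := K2 b /\
  ((f b < t%:Z /\ ~~ (q%:Z %| f b - r%:Z)%Z) \/ t'%:Z <= f b).
have R0 : 0 \notin R by apply/negP => /RK[_ /eqP].
have L0 : L 0 by split=> //; [exact: (gs0 gs1) | apply: Or31; rewrite raddf0; lia].
exists t', R, L, U, [seq (3 * H2 + q * i)%N | i <- iota i0 d].
split; [split | | split | split | split].
- by [].
- by [].
- by move=> a /RK[].
- move=> a b [Ka aR _] [Kb bR _]; apply/negP => abR.
  have [a0|a0] := eqVneq a 0; first by rewrite a0 add0r (negPf bR) in abR.
  have [b0|b0] := eqVneq b 0; first by rewrite b0 addr0 (negPf aR) in abR.
  have fb := gs_ge0 gs1 Kb.
  have fb0 : f b <> 0 by move=> /(gs_eq0 gs1 Kb)/eqP; rewrite (negPf b0).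
  have /negP[] := aR; apply: Rlow abR Ka a0 _.
  by rewrite raddfD /=; lia.
(* Above [h], a part [g] of height divisible by [q] is split off so that the rest has height between
   [s * p] and [h]; both parts are then too high for [R]. *)
- move=> a Ka aR; have [fa|fa] := lerP (f a) h%:Z.
    by exists a, 0; rewrite addr0; split=> //; split=> //; apply: Or31.
  have [|g [Kg dg qg Kag /andP[l u]]] := gs_subq gs1 q (s * p) a q0 Ka.
    by rewrite -hE.
  rewrite -hE in u.
  exists g, (a - g); split; last by rewrite [RHS]addrC subrK.
    split=> //; last exact: Or32.
    by apply/negP => /RK[_ _ hg]; lia.
  split=> //; last exact: Or31.
  by apply/negP => /RK[_ _ hg]; lia.
- move=> b Kb; have [fb|fb] := lerP t'%:Z (f b).
    exists b, 0; rewrite addr0; split=> //; first by split=> //; right.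
    split; first exact: (gs0 gs2).
    left; rewrite raddf0; split; first by lia.
    by rewrite sub0r dvdzE abszN /=; apply/negP => /dvdn_leq; lia.
  have [||b1 [b2 [[-> k1 k2 f1 f2] [n1 n2]]]] :=
     gs_sum_coset_free gs2 q r t b H20 _ rH rq tH Kb.
  - exact: leq_ltn_trans rH rq.
  - by clear -fb t'2; lia.
  by exists b1, b2; split=> //; split=> //; left.
- by move=> a [].
- by move=> a Ka aR fa; split=> //; apply: Or33.
- by move=> a [].
- by move=> a Ka fa; split=> //; right.
- rewrite map_inj_uniq ?iota_uniq // => i j; nia.
- by rewrite size_map size_iota.
(* By height alone, [f b < t] and [q] divides [f a]; then [f b] is congruent to [r], which [U]
   excludes below [t]. *)
- move=> c /mapP[i]; rewrite mem_iota => /andP[i1 i2] -> a b [Ka aR La] [Kb Ub].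
  move=> /(congr1 f); rewrite raddfD raddfMn /= hp -mulr_natl natz => fm.
  have fa := gs_ge0 gs1 Ka; have fb := gs_ge0 gs2 Kb.
  have e : ((3 * H2 + q * i)%N%:Z * p%:Z) = (r + q * p * i)%N%:Z.
    by rewrite rE -PoszM mulnDl [(q * i * p)%N]mulnAC.
  rewrite e in fm.
  have m1 : (t + h <= q * p * i)%N by apply: leq_trans thi _; rewrite leq_mul2l i1 orbT.
  have m2 : (r + q * p * i < t')%N.
    apply: leq_trans (_ : q * p * i.+1 <= t')%N; first by rewrite mulnSr; lia.
    by rewrite -it' leq_mul2l i2 orbT.
  case: Ub => [[bt nb]|]; last by lia.
  case: La => [|da|]; [by lia | | by lia].
  case/negP: nb; have -> : f b - r%:Z = (q * p * i)%N%:Z - f a by clear -fm; lia.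
  by rewrite rpredB // -mulnA PoszM dvdz_mulr.
Qed.

End Fringe.

(** * Counting sets that avoid a sum *)

Section AvoidSum.
Local Open Scope fset_scope.

Lemma card_up_closed {T : choiceType} (F : {fset {fset T}}) (x : T) :
  {in F, forall A, x |` A \in F} ->
  (#|` F| <= 2 * #|` [fset A in F | x \in A]|)%N.
Proof.
move=> up; rewrite -(cardfsID [fset A in F | x \in A] F).
have -> : F `&` [fset A in F | x \in A] = [fset A in F | x \in A].
  by apply/fsetIidPr/fsubsetP => A; rewrite !inE => /andP[].
rewrite mul2n -addnn leq_add2l.
pose G := F `\` [fset A in F | x \in A]; rewrite -/G; have <- : #|` [fset x |` A | A in G]| = #|` G|.
  apply: card_in_imfset; 
  move=> A B; rewrite !inE /= => /andP[+ AF] /andP[+ BF] e.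
  rewrite AF BF /= => xA xB; apply/fsetP => y.
  have [->|ne] := eqVneq y x; first by rewrite (negPf xA) (negPf xB).
  by move/fsetP/(_ y): e; rewrite !inE (negPf ne).
apply/fsubset_leq_card/fsubsetP => B /imfsetP[A /=]; rewrite !inE /= => /andP[_ AF] ->.
by rewrite up // !inE eqxx.
Qed.

(* Each pair [{z, k - z}] costs a factor 3/4, as among the sets avoiding the
   other pairs at least a quarter contain both [z] and [k - z]. *)
Lemma card_avoid_sum {T : zmodType} (k : T) (H I X : {fset T}) (r : nat) :
  {in X, forall z, (z \in H) && (k - z \in H)} -> (2 * r <= #|` X|)%N ->
  (expn 4 r * #|` [fset A in fpowerset H | (I `<=` A) &&
                  all (fun z => ~~ ((z \in A) && ((k - z)%R \in A))) X]|
   <= expn 3 r * #|` [fset A in fpowerset H | I `<=` A]|)%N.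
Proof.
pose F (X : {fset T}) := [fset A in fpowerset H | (I `<=` A) &&
                  all (fun z => ~~ ((z \in A) && ((k - z)%R \in A))) X].
rewrite -/(F X); elim: r X => [|r IH] X HX rX.
  rewrite !expn0 !mul1n; apply/fsubset_leq_card/fsubsetP => A.
  by rewrite !inE => /and3P[-> ->].
have [z zX] : exists z, z \in X by apply/fset0Pn; rewrite -cardfs_gt0; lia.
have /andP[zH kzH] := HX z zX.
pose X' := X `\` [fset z; k - z].
have X'X : X' `<=` X by apply: fsubsetDl.
have rX' : (2 * r <= #|` X'|)%N.
  rewrite cardfsD; have : (#|` X `&` [fset z; (k - z)%R]| <= 2)%N.
    by apply: leq_trans (fsubset_leq_card (fsubsetIr _ _)) _; rewrite cardfs2; case: eqP.
  by lia.
have {}IH := IH X' (fun y yX => HX y (fsubsetP X'X y yX)) rX'.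
(* A constraint indexed by [X'] involves neither [z] nor [k - z], so adding one of these points
   violates none of them. *)
have up y (G : {fset T} -> bool) : y \in [fset z; k - z] ->
  (forall A, G A -> G (y |` A)) ->
  {in [fset A in F X' | G A], forall A, y |` A \in [fset A in F X' | G A]}.
  move=> yz GA A; rewrite !inE /= => /andP[/and3P[AH IA /allP avoid] gA].
  rewrite !fpowersetE in AH *; rewrite GA // andbT fsubUset AH andbT.
  rewrite fsub1set (fsubset_trans IA (fsubsetUr _ _)) /=.
  have -> /= : y \in H by move: yz; rewrite !inE => /orP[] /eqP->.
  apply/allP => x xX'; have := avoid x xX'; rewrite !inE.
  move: xX'; rewrite !inE negb_or => /andP[/andP[xz xkz] _].
  have -> : (x == y) = false.
    by move: yz; rewrite !inE => /orP[] /eqP->; apply/negbTE.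
  have -> // : (k - x == y) = false.
  move: yz; rewrite !inE => /orP[] /eqP->; apply/negbTE.
    by apply: contra xkz => /eqP <-; rewrite subKr.
  by rewrite (inj_eq (addrI k)) eqr_opp.
have c1 : (#|` F X'| <= 2 * #|` [fset A in F X' | z \in A]|)%N.
  apply: card_up_closed => A AF.
  have := up z predT; rewrite !inE eqxx => /(_ isT (fun _ _ => isT) A).
  by rewrite !inE in AF *; rewrite !andbT => ->.
have c2 : (#|` [fset A in F X' | z \in A]| <=
    2 * #|` [fset A in [fset A in F X' | z \in A] | (k - z)%R \in A]|)%N.
  apply: card_up_closed; apply: up; first by rewrite !inE eqxx orbT.
  by move=> A zA; rewrite !inE zA orbT.
set B := [fset A in [fset A in F X' | z \in A] | (k - z)%R \in A] in c2.
have FB : F X `<=` F X' `\` B.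
  apply/fsubsetP => A; rewrite !inE /= => /and3P[AH IA /allP avoid].
  rewrite AH IA /= !negb_and -!orbA.
  have -> : all (fun z0 => ~~ ((z0 \in A) && (k - z0 \in A))) X'.
    by apply/allP => y /(fsubsetP X'X) /avoid.
  by rewrite andbT; have := avoid z zX; rewrite negb_and => /orP[->|->]; rewrite ?orbT.
have BF : B `<=` F X' by apply/fsubsetP => A; rewrite !inE => /andP[/andP[]].
have := fsubset_leq_card FB; rewrite cardfsDS // => c3.
have c4 := fsubset_leq_card BF.
rewrite !expnS; set a := #|` F X| in c3 *; set b := #|` F X'| in c1 c3 c4 IH.
set c := #|` B| in c2 c3 c4; set e := #|` _| in c1 c2.
have h : (4 * a <= 3 * b)%N by lia.
apply: leq_trans (_ : expn 4 r * (3 * b) <= _)%N.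
  by rewrite -mulnA mulnCA leq_mul2l h orbT.
by rewrite mulnCA -mulnA leq_mul2l IH orbT.
Qed.

End AvoidSum.

(** * The l1 norm and additive functionals on the lattice *)

Section Lattice.
Context {D : nat}.
Implicit Types (a b z : zpt D).

Lemma toRD a b : toR (a + b) = toR a + toR b.
Proof. by apply/rowP => i; rewrite !mxE rmorphD. Qed.

Lemma toRN a : toR (- a) = - toR a.
Proof. by apply/rowP => i; rewrite !mxE rmorphN. Qed.

Lemma toRB a b : toR (a - b) = toR a - toR b.
Proof. by rewrite toRD toRN. Qed.

Lemma toRMn a n : toR (a *+ n) = n%:R *: toR a.
Proof. by apply/rowP => i; rewrite !mxE mulmxnE rmorphMn /= mulr_natl. Qed.

Definition l1 z : nat := (\sum_i `|z 0%R i|)%N.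

Lemma l1E z : (l1 z)%:R = \sum_i `|toR z 0 i| :> R.
Proof.
rewrite natr_sum; apply: eq_bigr => i _.
by rewrite mxE -intr_norm -abszE.
Qed.

Lemma l1N z : l1 (- z) = l1 z.
Proof. by apply: eq_bigr => i _; rewrite mxE abszN. Qed.

Lemma l1D a b : (l1 (a + b) <= l1 a + l1 b)%N.
Proof.
by rewrite -big_split; apply: leq_sum => i _; rewrite mxE /=; lia.
Qed.

Lemma l1_eq0 z : l1 z = 0%N -> z = 0.
Proof.
move=> /eqP; rewrite sum_nat_eq0 => /forallP h; apply/rowP => i.
by apply/eqP; rewrite mxE -absz_eq0; apply: h.
Qed.

Lemma l1_ball_finite (b : nat) : exists X : seq (zpt D), forall z, (l1 z <= b)%N -> z \in X.
Proof.
exists [seq \row_i ((phi i : nat)%:Z - b%:Z) | phi : {ffun 'I_D -> 'I_(2 * b).+1}] => z zb.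
have zi i : (`|z 0%R i| <= b)%N.
  by apply: leq_trans zb; rewrite /l1 (bigD1 i) //= leq_addr.
apply/imageP; exists [ffun i => inord `|(z 0 i + b%:Z)%R|%N] => //.
by apply/rowP => i; rewrite mxE ffunE inordK; move: (z 0 i) (zi i) => y; lia.
Qed.

Lemma additive_coord (f : {additive zpt D -> int}) z :
  f z = \sum_i z 0 i * f (delta_mx 0 i).
Proof.
rewrite {1}(row_sum_delta z) raddf_sum; apply: eq_bigr => i _.
by rewrite -[z 0 i]intz scaler_int raddfMz -mulrzl.
Qed.

Lemma additive_l1 (f : {additive zpt D -> int}) :
  exists C : nat, forall z, `|f z| <= (C * l1 z)%N%:Z.
Proof.
exists (\sum_i `|f (delta_mx 0%R i)|)%N => z; rewrite additive_coord.
rewrite PoszM -[X in _ * X]natz natr_sum mulr_sumr.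
apply: le_trans (ler_norm_sum _ _ _) _; apply: ler_sum => i _.
rewrite normrM mulrC natz abszE ler_wpM2r // -abszE lez_nat.
by rewrite (bigD1 i) //= leq_addr.
Qed.

End Lattice.

(** * Lattice cones and their grading *)

Section Cone.
Context {D N : nat}.
Implicit Types (a b z : zpt D) (e : 'I_N -> zpt D).

Definition cone e a : Prop :=
  exists c : 'I_N -> R, (forall i, 0 <= c i) /\ toR a = \sum_i c i *: toR (e i).

Lemma additive_comb (f : {additive zpt D -> int}) e (c : 'I_N -> R) a :
  toR a = \sum_i c i *: toR (e i) -> (f a)%:~R = \sum_i c i * (f (e i))%:~R :> R.
Proof.
move=> ha; have fE z : (f z)%:~R = \sum_j toR z 0 j * (f (delta_mx 0 j))%:~R :> R.
  by rewrite additive_coord rmorph_sum; apply: eq_bigr => j _; rewrite mxE rmorphM.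
rewrite fE ha; under [RHS]eq_bigr => i _ do rewrite fE mulr_sumr.
rewrite exchange_big; apply: eq_bigr => j _.
by rewrite summxE mulr_suml; apply: eq_bigr => i _; rewrite mxE mulrA.
Qed.

Lemma l1_comb e (c : 'I_N -> R) a : (forall i, 0 <= c i) ->
  toR a = \sum_i c i *: toR (e i) -> (l1 a)%:R <= \sum_i c i * (l1 (e i))%:R :> R.
Proof.
move=> c0 ha; rewrite l1E ha; under [leRHS]eq_bigr => i _ do rewrite l1E mulr_sumr.
rewrite exchange_big; apply: ler_sum => j _.
rewrite summxE; apply: le_trans (ler_norm_sum _ _ _) _; apply: ler_sum => i _.
by rewrite mxE normrM ger0_norm.
Qed.

Lemma cone_opp e a : cone e (- a) -> cone (fun i => - e i) a.
Proof.
case=> c [c0 ha]; exists c; split=> //.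
rewrite -[a]opprK toRN ha -sumrN; apply: eq_bigr => i _.
by rewrite toRN scalerN.
Qed.

Lemma cone_mem e i (m : nat) : cone e (e i *+ m).
Proof.
exists (fun j => (i == j)%:R * m%:R); split=> [j|]; first by rewrite mulr_ge0 ?ler0n.
rewrite (bigD1 i) //= eqxx mul1r big1 ?addr0 ?toRMn // => j ji.
by rewrite eq_sym (negPf ji) mul0r scale0r.
Qed.

Section Graded.
Variables (f : {additive zpt D -> int}) (e : 'I_N -> zpt D).
Hypothesis fe : forall i, e i != 0 -> 0 < f (e i).

Let fe_ge0 i : 0 <= f (e i).
Proof. by have [->|/fe/ltW//] := eqVneq (e i) 0; rewrite raddf0. Qed.

(* Terms with [e i = 0] carry arbitrary coefficients, hence are left out. *)
Lemma cone_coef_le a (c : 'I_N -> R) : (forall i, 0 <= c i) ->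
  toR a = \sum_i c i *: toR (e i) -> \sum_(i | e i != 0) c i <= (f a)%:~R.
Proof.
move=> c0 ha; rewrite (additive_comb f _ _ _ ha) [leRHS](bigID (fun i => e i != 0)) /=.
rewrite -[leLHS]addr0; apply: lerD.
  apply: ler_sum => i ei; rewrite -[leLHS]mulr1 ler_wpM2l //.
  by rewrite (ler_int _ 1); have := fe i ei; lia.
by apply: sumr_ge0 => i _; rewrite mulr_ge0 // (ler_int _ 0).
Qed.

Lemma cone_ge0 a : cone e a -> 0 <= f a.
Proof.
case=> c [c0 ha]; rewrite -(ler_int R); apply: le_trans (cone_coef_le _ _ c0 ha).
exact: sumr_ge0.
Qed.

(** The height bounds the total coefficient on nonzero generators, each of norm at most [B]. Hence
    only finitely many points lie below a given height. *)
Lemma cone_l1_le (B : nat) a : (forall i, (l1 (e i) <= B)%N) -> cone e a ->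
  (l1 a)%:Z <= B%:Z * f a.
Proof.
move=> eB [c [c0 ha]]; rewrite -(ler_int R) rmorphM /= -!pmulrn.
apply: le_trans (l1_comb _ _ _ c0 ha) _.
apply: le_trans (_ : B%:R * \sum_(i | e i != 0) c i <= _); last first.
  by rewrite ler_wpM2l // cone_coef_le.
rewrite (bigID (fun i => e i != 0)) /= [X in _ + X]big1 ?addr0.
  by rewrite mulr_sumr; apply: ler_sum => i _; rewrite mulrC ler_wpM2r // ler_nat.
move=> i /negPn/eqP ->; suff -> : l1 (0 : zpt D) = 0%N by rewrite mulr0.
by rewrite /l1 big1 // => j _; rewrite mxE.
Qed.

Lemma cone_graded : exists2 H, (0 < H)%N & graded_semigroup f (cone e) H.
Proof.
pose B := (\sum_i l1 (e i))%N; pose H := (\sum_i `|f (e i)|)%N.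
have eB i : (l1 (e i) <= B)%N by rewrite /B (bigD1 i) //= leq_addr.
have eH i : f (e i) <= H%:Z.
  apply: le_trans (_ : (`|f (e i)|%N)%:Z <= _); first by lia.
  by rewrite lez_nat /H (bigD1 i) //= leq_addr.
exists H.+1 => //; split.
- exists (fun=> 0); split=> //; rewrite big1 => [|i _]; last by rewrite scale0r.
  by apply/rowP => i; rewrite !mxE.
- move=> a b [c [c0 ha]] [c' [c'0 hb]]; exists (fun i => c i + c' i); split.
    by move=> i; rewrite addr_ge0.
  by rewrite toRD ha hb -big_split; apply: eq_bigr => i _; rewrite scalerDl.
- exact: cone_ge0.
- move=> a Ka fa; apply: l1_eq0; apply/eqP; rewrite -leqn0.
  by have := cone_l1_le B a eB Ka; rewrite fa mulr0 lez_nat.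
- move=> h; have [X hX] := @l1_ball_finite D (B * h); exists X => a Ka fa.
  apply: hX; rewrite -lez_nat PoszM; apply: le_trans (cone_l1_le B a eB Ka) _.
  by rewrite ler_wpM2l.
- move=> q a q0 [c [c0 ha]] fa.
  (* If all coefficients on nonzero generators were below [q], the height would be at most [q * H].
     So some coefficient is at least [q], and [q] copies of its generator can be removed. *)
  have [i ei ci] : exists2 i, e i != 0 & q%:R <= c i.
    apply: contrapT => no; have {}no i : e i != 0 -> c i < q%:R.
      by move=> ei; rewrite ltNge; apply/negP => ci; apply: no; exists i.
    move: fa; rewrite -(ltr_int R) (additive_comb f _ _ _ ha); apply/negP.
    rewrite -leNgt -pmulrn (le_trans _ (_ : (q * H)%N%:R <= _)) ?ler_nat ?leq_mul2l ?leqnSn ?orbT //.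
    rewrite natrM natr_sum mulr_sumr; apply: ler_sum => i _.
    rewrite natr_absz ger0_norm //.
    have [->|ei] := eqVneq (e i) 0; first by rewrite raddf0 !mulr0.
    by rewrite ler_wpM2r ?(ler_int _ 0) // ltW // no.
  exists (e i); split=> //; first by rewrite -[e i]mulr1n; exact: cone_mem.
  - exact: fe.
  - by apply: le_trans (eH i) _; rewrite lez_nat.
  exists (fun j => c j - (i == j)%:R * q%:R); split=> [j|].
    by have [<-|_] := eqVneq i j; rewrite ?mul1r ?mul0r ?subr0 // subr_ge0.
  rewrite toRB ha toRMn; under [RHS]eq_bigr do rewrite scalerBl.
  rewrite sumrB; congr (_ - _); rewrite (bigD1 i) //= eqxx mul1r big1 ?addr0 //.
  by move=> j ji; rewrite eq_sym (negPf ji) mul0r scale0r.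
Qed.

End Graded.
End Cone.

(** * Lattice points of dilates *)

Section Dilate.
Context {D : nat} (V : seq (zpt D)).
Implicit Types (p t x y z : zpt D).

Local Notation v i := (nth 0 V i).

(** The weights themselves sum to [n], so that integer amounts of weight can be moved between points
    of [V]. *)
Definition scaled (n : nat) z : Prop := exists lam : 'I_(size V) -> R,
  [/\ forall i, 0 <= lam i, \sum_i lam i = n%:R & toR z = \sum_i lam i *: toR (v i)].

Lemma in_dil_scaled n z : (0 < n)%N -> in_dil V n z <-> scaled n z.
Proof.
move=> n0; have nR : n%:R != 0 :> R by rewrite pnatr_eq0 -lt0n.
split=> [[lam [l0 [l1 hz]]]|[lam [l0 l1 hz]]].
  exists (fun i => n%:R * lam i); split=> [i||]; first by rewrite mulr_ge0.
    by rewrite -mulr_sumr l1 mulr1.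
  by rewrite hz scaler_sumr; apply: eq_bigr => i _; rewrite scalerA.
exists (fun i => n%:R^-1 * lam i); split=> [i|]; first by rewrite mulr_ge0 // invr_ge0.
split; first by rewrite -mulr_sumr l1 mulVf.
rewrite hz scaler_sumr; apply: eq_bigr => i _.
by rewrite scalerA mulrA mulfV // mul1r.
Qed.

Lemma comb_shift n z p (lam : 'I_(size V) -> R) : \sum_i lam i = n%:R ->
  toR z = \sum_i lam i *: toR (v i) ->
  toR (z - p *+ n) = \sum_i lam i *: toR (v i - p).
Proof.
move=> l1 hz; rewrite toRB toRMn hz -l1 scaler_suml -sumrB.
by apply: eq_bigr => i _; rewrite toRB scalerBr.
Qed.

Lemma scaled_cone n z p : scaled n z -> cone (fun i : 'I_(size V) => v i - p) (z - p *+ n).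
Proof. by case=> lam [l0 l1 hz]; exists lam; split=> //; exact: comb_shift. Qed.

Lemma scaled_near_l1 n z p (lam : 'I_(size V) -> R) (B q : nat) :
  (forall i, 0 <= lam i) -> \sum_i lam i = n%:R ->
  toR z = \sum_i lam i *: toR (v i) ->
  {in V &, forall a b, (l1 (a - b) <= B)%N} -> p \in V ->
  \sum_(i < size V | v i != p) lam i <= q%:R -> (l1 (z - p *+ n) <= B * q)%N.
Proof.
move=> l0 ls hz VB pV lq; rewrite -(ler_nat R).
apply: le_trans (l1_comb _ _ _ l0 (comb_shift _ _ p _ ls hz)) _.
rewrite (bigID (fun i : 'I_(size V) => v i != p)) /= [X in _ + X]big1 ?addr0.
  rewrite natrM; apply: le_trans (_ : B%:R * \sum_(i < size V | v i != p) lam i <= _).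
    rewrite mulr_sumr; apply: ler_sum => i _; rewrite mulrC ler_wpM2r // ler_nat.
    by rewrite VB // mem_nth.
  by rewrite ler_wpM2l.
move=> i /negPn/eqP ->; rewrite subrr; suff -> : l1 (0 : zpt D) = 0%N by rewrite mulr0.
by rewrite /l1 big1 // => j _; rewrite mxE.
Qed.

(** The total weight off [p] is at most the height [f a], hence at most [n], and the rest can be
    given to [p]. So up to height [n] the dilate contains the whole tangent cone at [p *+ n]. *)
Lemma cone_scaled (f : {additive zpt D -> int}) n a p :
  p \in V -> {in V, forall b, b != p -> 0 < f (b - p)} ->
  cone (fun i : 'I_(size V) => v i - p) a -> f a <= n%:Z -> scaled n (p *+ n + a).
Proof.
move=> pV fp [c [c0 ha]] fa.
have fe i : v (i : 'I_(size V)) - p != 0 -> 0 < f (v i - p).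
  by rewrite subr_eq0 => h; apply: fp => //; apply: mem_nth.
have cn : \sum_(i < size V | v i != p) c i <= n%:R.
  apply: le_trans (_ : (f a)%:~R <= _); last by rewrite pmulrn ler_int.
  under eq_bigl => i do rewrite -subr_eq0.
  exact: (cone_coef_le f _ fe _ _ c0 ha).
set S := \sum_(i < _ | _) _ in cn.
have ip : (index p V < size V)%N by rewrite index_mem.
pose k : 'I_(size V) := Ordinal ip.
have vk : v k = p by rewrite nth_index.
(* [V] may list [p] several times: the coefficients at all its occurrences are dropped, and the
   remaining weight [n - S] goes to the first one, [k]. *)
exists (fun i : 'I_(size V) => (if v i != p then c i else 0) + (i == k)%:R * (n%:R - S)).
split=> [i||].
- rewrite addr_ge0 //; first by case: ifP.
  by rewrite mulr_ge0 // subr_ge0.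
- rewrite big_split /= -big_mkcond -/S -mulr_suml (bigD1 k) //= eqxx big1.
    by rewrite addr0 mul1r addrC subrK.
  by move=> i /negPf ->.
under eq_bigr do rewrite scalerDl.
rewrite big_split /= [X in _ = _ + X](bigD1 k) //= eqxx mul1r vk [X in _ = _ + (_ + X)]big1; last first.
  by move=> i /negPf ->; rewrite mul0r scale0r.
rewrite addr0 toRD toRMn ha scalerBl [RHS]addrCA; congr (_ + _).
rewrite /S scaler_suml [X in _ - X]big_mkcond -sumrB; apply: eq_bigr => i _.
rewrite toRB scalerBr.
by have [->|_] := eqVneq (v i) p; rewrite /= ?scale0r ?subrr ?scaler0 ?subr0.
Qed.

Lemma scaled_move n z (lam : 'I_(size V) -> R) (a b : 'I_(size V)) (j : nat) :
  (forall i, 0 <= lam i) -> \sum_i lam i = n%:R ->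
  toR z = \sum_i lam i *: toR (v i) -> j%:R <= lam b ->
  scaled n (z + (v a - v b) *+ j).
Proof.
move=> l0 ls hz jb.
have sum1 (c : 'I_(size V)) : \sum_i (i == c)%:R * j%:R = j%:R :> R.
  rewrite (bigD1 c) //= eqxx mul1r big1 ?addr0 // => i /negPf ->.
  by rewrite mul0r.
have sumv (c : 'I_(size V)) : \sum_i ((i == c)%:R * j%:R) *: toR (v i) = j%:R *: toR (v c).
  rewrite (bigD1 c) //= eqxx mul1r big1 ?addr0 // => i /negPf ->.
  by rewrite mul0r scale0r.
exists (fun i => lam i + (i == a)%:R * j%:R - (i == b)%:R * j%:R); split=> [i||].
- have [->|_] := eqVneq i b; last by rewrite mul0r subr0 addr_ge0 // mulr_ge0.
  by rewrite mul1r addrAC addr_ge0 ?subr_ge0 // mulr_ge0.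
- by rewrite sumrB big_split /= !sum1 addrK.
under eq_bigr do rewrite scalerBl scalerDl.
rewrite sumrB big_split /= !sumv toRD toRMn toRB hz -addrA.
by rewrite scalerBr.
Qed.

Lemma exists_large_weight n (m : nat) (lam : 'I_(size V) -> R) : V != [::] ->
  \sum_i lam i = n%:R -> (size V * m <= n)%N -> exists i, m%:R <= lam i.
Proof.
move=> V0 ls mn; apply: contrapT => no.
have {}no i : lam i < m%:R by rewrite ltNge; apply/negP => ?; apply: no; exists i.
have i0 : 'I_(size V) by exists 0%N; rewrite lt0n size_eq0.
have : \sum_i lam i < \sum_(i < size V) m%:R.
  rewrite (bigD1 i0) //= [ltRHS](bigD1 i0) //=; apply: ltr_leD => //.
  by apply: ler_sum => i _; apply: ltW.
by rewrite ls sumr_const card_ord -[m%:R *+ _]mulr_natl -natrM ltr_nat ltnNge mn.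
Qed.

(** If [x] has weight at least [m] on some [v b] and [y] on some [v a] different from it, moving
    weight in opposite directions gives the progressions. Otherwise, for large [n], the pigeonhole
    principle puts large weights of both on a single [p], and all weights off [p] are below [m]. For
    small [n] everything is near. *)
Lemma near_or_progression n m x y (B : nat) : V != [::] ->
  {in V &, forall a b, (l1 (a - b) <= B)%N} -> scaled n x -> scaled n y ->
  (exists2 p, p \in V & (l1 (x - p *+ n) <= B * (size V * m))%N /\
                        (l1 (y - p *+ n) <= B * (size V * m))%N) \/
  exists2 t, t != 0 & forall j, (j <= m)%N -> scaled n (x + t *+ j) /\ scaled n (y - t *+ j).
Proof.
move=> V0 VB [la [l0 ls hx]] [mu [m0 ms hy]].
have small (lam : 'I_(size V) -> R) p : (forall i, 0 <= lam i) -> \sum_i lam i = n%:R ->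
    (forall i : 'I_(size V), v i != p -> lam i < m%:R) \/ (n < size V * m)%N ->
    \sum_(i < size V | v i != p) lam i <= (size V * m)%N%:R.
  move=> c0 cs [h|h].
    apply: le_trans (_ : \sum_(i < size V | v i != p) m%:R <= _).
      by apply: ler_sum => i /h/ltW.
    rewrite big_mkcond natrM mulr_natl -[size V in leRHS]card_ord -sumr_const.
    by apply: ler_sum => i _; case: ifP.
  apply: le_trans (_ : \sum_i lam i <= _); last by rewrite cs ler_nat ltnW.
  by rewrite [leRHS](bigID (fun i : 'I_(size V) => v i != p)) /= lerDl sumr_ge0.
have [nm|nm] := ltnP n (size V * m).
  have pV : v 0 \in V by rewrite mem_nth // lt0n size_eq0.
  left; exists (v 0) => //; split.
    by exact: scaled_near_l1 l0 ls hx VB pV (small _ _ l0 ls (or_intror nm)).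
  by exact: scaled_near_l1 m0 ms hy VB pV (small _ _ m0 ms (or_intror nm)).
have [[a [b [ab la_b mu_a]]]|no] :=
    pselect (exists a b : 'I_(size V), [/\ v a != v b, m%:R <= la b & m%:R <= mu a]).
  right; exists (v a - v b); rewrite ?subr_eq0 // => j jm.
  have jmR : j%:R <= m%:R :> R by rewrite ler_nat.
  split; first exact: scaled_move l0 ls hx (le_trans jmR la_b).
  rewrite -mulNrn opprB; exact: scaled_move m0 ms hy (le_trans jmR mu_a).
have [b0 lb0] := exists_large_weight n m la V0 ls nm.
have [a0 ma0] := exists_large_weight n m mu V0 ms nm.
have vab : v a0 = v b0.
  by apply/eqP/negPn/negP => h; apply: no; exists a0, b0.
have pV : v a0 \in V by apply: mem_nth.
left; exists (v a0) => //; split.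
  apply: scaled_near_l1 l0 ls hx VB pV (small _ _ l0 ls (or_introl _)) => i iv.
  by rewrite ltNge; apply/negP => ?; apply: no; exists a0, i; rewrite eq_sym.
apply: scaled_near_l1 m0 ms hy VB pV (small _ _ m0 ms (or_introl _)) => i iv.
by rewrite ltNge; apply/negP => ?; apply: no; exists i, b0; rewrite -vab.
Qed.

End Dilate.

(** * Lattice sums and generic functionals *)

Lemma geometric_le (th : R) n : 0 <= th -> th < 1 -> \sum_(i < n) th ^+ i <= (1 - th)^-1.
Proof.
move=> t0 t1; have h : 0 < 1 - th by rewrite subr_gt0.
rewrite -[leRHS]mulr1 ler_pdivlMl //.
have -> : (1 - th) * \sum_(i < n) th ^+ i = 1 - th ^+ n.
  by rewrite -[1 - th ^+ n]opprB subrX1 -mulNr opprB.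
by rewrite gerBl exprn_ge0.
Qed.

(** Coding each coordinate by sign and absolute value turns the weight into a product; the sum over
    all codes factors into [D] sums, each twice a geometric one. *)
Lemma sum_expr_l1_le {D : nat} (th : R) (X : seq (zpt D)) : uniq X -> 0 <= th -> th < 1 ->
  \sum_(z <- X) th ^+ l1 z <= (2 / (1 - th)) ^+ D.
Proof.
move=> uX t0 t1; pose b := (\sum_(z <- X) l1 z)%N.
have lb z i : z \in X -> (`|z 0%R i| <= b)%N.
  move=> zX; rewrite /b (big_rem z) //= /l1 (bigD1 i) //= -addnA leq_addr //.
pose code (z : zpt D) : {ffun 'I_D -> bool * 'I_b.+1} :=
  [ffun i => (0 <= z 0 i, inord `|z 0%R i|%N)].
pose w (phi : {ffun 'I_D -> bool * 'I_b.+1}) := \prod_i th ^+ (phi i).2.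
have w0 phi : 0 <= w phi by apply: prodr_ge0 => i _; apply: exprn_ge0.
have -> : \sum_(z <- X) th ^+ l1 z = \sum_(phi <- map code X) w phi.
  rewrite big_map big_seq [RHS]big_seq; apply: eq_bigr => z zX.
  rewrite /w /l1 expr_sum; apply: eq_bigr => i _.
  by rewrite ffunE /= inordK // ltnS lb.
have inj : {in X &, injective code}.
  move=> x y xX yX /ffunP e; apply/rowP => i; have := e i; rewrite !ffunE => -[s].
  move/(congr1 (fun j : 'I_b.+1 => j : nat)); rewrite !inordK ?ltnS ?lb //.
  by move: (x 0 i) (y 0 i) s => a c; lia.
rewrite big_uniq ?map_inj_in_uniq //=.
apply: le_trans (_ : \sum_phi w phi <= _).
  by rewrite [leRHS](bigID (fun phi => phi \in map code X)) /= lerDl sumr_ge0.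
rewrite -(bigA_distr_bigA (fun _ (p : bool * 'I_b.+1) => th ^+ p.2)) /=.
rewrite prodr_const card_ord; apply: lerXn2r.
- by rewrite nnegrE sumr_ge0 // => p _; apply: exprn_ge0.
- by rewrite nnegrE divr_ge0 // subr_ge0 ltW.
rewrite -(pair_bigA _ (fun (_ : bool) (j : 'I_b.+1) => th ^+ j)) /= big_bool /=.
by rewrite mulr_natl mulr2n lerD ?geometric_le.
Qed.

(** Reading [z] as the coefficients of a polynomial and evaluating at an integer [m] is additive.
    The product of these polynomials over [S] is nonzero, so some [m] is a root of none of them. *)
Lemma exists_separating_additive {D : nat} (S : seq (zpt D)) : 0 \notin S ->
  exists f : {additive zpt D -> int}, {in S, forall z, f z != 0}.
Proof.
move=> S0; pose P : {poly int} := \prod_(z <- S) rVpoly z.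
have P0 : P != 0.
  rewrite prodf_seq_neq0; apply/allP => z zS /=.
  by apply: contraNneq S0 => h; rewrite -(rVpolyK z) h linear0 in zS.
have [m Pm] : exists m : nat, ~~ root P m%:Z.
  apply: contrapT => no.
  have allr : all (root P) [seq m%:Z | m <- iota 0 (size P)].
    by apply/allP => _ /mapP[m _ ->]; apply/negPn/negP => h; apply: no; exists m.
  have := max_poly_roots P0 allr; rewrite map_inj_uniq ?iota_uniq; last by move=> i j [].
  by rewrite size_map size_iota ltnn => /(_ isT).
pose f : {additive zpt D -> int} := (horner_eval m%:Z \o @rVpoly int D).
exists f => z zS; rewrite /f /= /horner_eval; apply: contra Pm => /eqP h.
rewrite /root horner_prod (big_rem z) //= h mul0r //.
Qed.

(** A functional that vanishes on no nonzero difference is injective on [V], so its extreme values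
    are each attained at one point. *)
Lemma exists_extreme_pair {D : nat} (V : seq (zpt D)) :
  (exists2 u, u \in V & exists2 v, v \in V & u != v) ->
  exists (f : {additive zpt D -> int}) u v,
  [/\ u \in V, v \in V, f v < f u, {in V, forall p, p != u -> f p < f u} &
      {in V, forall p, p != v -> f v < f p}].
Proof.
move=> [a aV [b bV ab]].
have [|f hf] := exists_separating_additive [seq z <- allpairs (fun x y => x - y) V V | z != 0].
  by rewrite mem_filter eqxx.
have f_inj : {in V &, injective f}.
  move=> x y xV yV e; apply/eqP; rewrite -subr_eq0; apply/negPn/negP => ne.
  have /negP[] : f (x - y) != 0 by apply: hf; rewrite mem_filter ne /=; apply/allpairsP; exists (x, y).
  by rewrite raddfB /= e subrr.
have iV : (index a V < size V)%N by rewrite index_mem.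
pose i0 : 'I_(size V) := Ordinal iV.
pose g (i : 'I_(size V)) := f (nth 0 V i).
case: (@Order.TotalTheory.arg_maxP _ _ _ i0 predT g isT) => i _ hi.
case: (@Order.TotalTheory.arg_minP _ _ _ i0 predT g isT) => j _ hj.
have hmax p : p \in V -> p != nth 0 V i -> f p < f (nth 0 V i).
  move=> pV ne; rewrite lt_neqAle (inj_in_eq f_inj) ?mem_nth // ne /=.
  have pi : (index p V < size V)%N by rewrite index_mem.
  by have := hi (Ordinal pi) isT; rewrite /g /= nth_index.
have hmin p : p \in V -> p != nth 0 V j -> f (nth 0 V j) < f p.
  move=> pV ne; rewrite lt_neqAle (inj_in_eq f_inj) ?mem_nth // eq_sym ne /=.
  have pi : (index p V < size V)%N by rewrite index_mem.
  by have := hj (Ordinal pi) isT; rewrite /g /= nth_index.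
exists f, (nth 0 V i), (nth 0 V j); split; rewrite ?mem_nth //.
have [e|ne] := eqVneq (nth 0 V i) (nth 0 V j); last by apply: hmin; rewrite ?mem_nth.
have [ai|/(hmax _ aV) h1] := eqVneq a (nth 0 V i).
  have /(hmax _ bV) h1 : b != nth 0 V i by rewrite -ai eq_sym.
  have [/eqP|/(hmin _ bV)] := boolP (b == nth 0 V j); last by lia.
  by rewrite -e => h; rewrite h ltxx in h1.
have [/eqP|/(hmin _ aV)] := boolP (a == nth 0 V j); last by lia.
by rewrite -e => h; rewrite h ltxx in h1.
Qed.

Lemma card_union_bound {T U : choiceType} (F : {fset T}) (K : seq U) (P : U -> T -> bool) :
  (#|` F| <= #|` [fset A in F | all (P^~ A) K]%fset| +
             \sum_(k <- K) #|` [fset A in F | ~~ P k A]%fset|)%N.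
Proof.
elim: K => [|k K IH].
  rewrite big_nil addn0; apply/fsubset_leq_card/fsubsetP => A AF.
  by rewrite !inE /= andbT.
apply: leq_trans IH _; rewrite big_cons addnA leq_add2r.
apply: leq_trans (leq_card_fsetU _ _); apply/fsubset_leq_card/fsubsetP => A.
rewrite !inE /= => /andP[-> ->] /=; rewrite andbT.
by case: (P k A).
Qed.

(** * Sets missing a sum with many representations *)

Section RandomPart.
Local Open Scope fset_scope.
Local Open Scope ring_scope.

Lemma in_sumset {D : nat} (X Y : {fset zpt D}) z :
  reflect (exists x y, [/\ x \in X, y \in Y & z = x + y]) (z \in sumset X Y).
Proof.
apply: (iffP (imfset2P _ _ _ _ _)) => [[x xX [y yY ->]]|[x [y [xX yY ->]]]].
  by exists x, y.
by exists x => //; exists y.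
Qed.

Lemma in_diffset {D : nat} (X Y : {fset zpt D}) z :
  reflect (exists x y, [/\ x \in X, y \in Y & z = x - y]) (z \in diffset X Y).
Proof.
apply: (iffP (imfset2P _ _ _ _ _)) => [[x xX [y yY ->]]|[x [y [xX yY ->]]]].
  by exists x, y.
by exists x => //; exists y.
Qed.

Lemma mulrn_inj {D : nat} (t : zpt D) : t != 0 -> injective (fun j : nat => t *+ j).
Proof.
move=> /rV0Pn[i ti] j k /rowP/(_ i); rewrite !mulmxnE.
have natM l : t 0 i *+ l = l%:Z * t 0 i by rewrite -mulr_natl natz.
by rewrite !natM => /(mulIf ti)[].
Qed.

(** The points [x + t *+ j] and [y - t *+ j] always sum to [x + y]. Discarding the at most [2 * e]
    indices where one of them lies in [E] leaves a set for [card_avoid_sum]; [r] is half its size,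
    as a pair may be met from both ends. *)
Lemma card_missing_le {D : nat} (Ln E I : {fset zpt D}) (e m : nat) (x y t : zpt D) :
  (#|` E| <= e)%N -> t != 0 ->
  (forall j, (j <= m)%N -> (x + t *+ j \in Ln) && (y - t *+ j \in Ln)) ->
  exists2 r, (m <= 2 * r + 2 * e)%N &
  (expn 4 r * #|` [fset A in [fset A in fpowerset (Ln `\` E) | I `<=` A]
                   | ~~ ((x + y)%R \in sumset A A)]|
   <= expn 3 r * #|` [fset A in fpowerset (Ln `\` E) | I `<=` A]|)%N.
Proof.
move=> Ee t0 prog; pose k := x + y.
pose s := [seq x + t *+ j | j <- iota 0 m.+1].
pose E' : {fset zpt D} := E `|` [fset k - z | z in E].
pose X : {fset zpt D} := seq_fset tt s `\` E'.
have kE j : k - (x + t *+ j) = y - t *+ j by rewrite /k opprD addrACA subrr add0r.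
have XH : {in X, forall z, (z \in Ln `\` E) && (k - z \in Ln `\` E)}.
  move=> z /fsetDP[zs zE]; move: zs zE; rewrite seq_fsetE => /mapP[j].
  rewrite mem_iota add0n ltnS => /andP[_ /prog/andP[xL yL]] zj.
  rewrite in_fsetU negb_or => /andP[zE zE'].
  rewrite !in_fsetD zE zj xL kE yL /= andbT -kE -zj.
  by apply: contra zE' => kz; apply/imfsetP; exists (k - z); rewrite //= subKr.
have cX : (m.+1 <= #|` X| + 2 * e)%N.
  have <- : #|` seq_fset tt s| = m.+1.
    rewrite size_seq_fset undup_id ?size_map ?size_iota //.
    by rewrite map_inj_uniq ?iota_uniq // => i j /addrI/(mulrn_inj _ t0).
  rewrite -(cardfsID E' (seq_fset tt s)) -/X addnC leq_add2l.
  apply: leq_trans (fsubset_leq_card (fsubsetIr _ _)) _.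
  apply: leq_trans (leq_card_fsetU _ _) _.
  by rewrite mul2n -addnn leq_add // (leq_trans (leq_imfset_card _ _ _)).
exists (#|` X| ./2); first by lia.
have rX : (2 * #|` X|./2 <= #|` X|)%N by lia.
apply: leq_trans (card_avoid_sum k (Ln `\` E) I X #|` X|./2 XH rX).
rewrite leq_mul2l; apply/orP; right; apply/fsubset_leq_card/fsubsetP => A.
rewrite !inE /= => /andP[/andP[-> ->]] /= kA; apply/allP => z _.
apply: contra kA => /andP[zA kzA]; apply/in_sumset; exists z, (k - z).
by rewrite [z + _]addrC subrK.
Qed.

Lemma bernoulli (x : R) n : 0 <= x -> x <= 1 -> 1 - n%:R * x <= (1 - x) ^+ n.
Proof.
move=> x0 x1; elim: n => [|n IH]; first by rewrite mul0r subr0 expr0.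
rewrite exprS; apply: le_trans (_ : (1 - x) * (1 - n%:R * x) <= _); last first.
  by rewrite ler_wpM2l // subr_ge0.
have : 0 <= n%:R * x * x by rewrite !mulr_ge0.
by rewrite -(natr1 n); lra.
Qed.

Lemma expr_small (th eps : R) : 0 <= th -> th < 1 -> 0 < eps -> exists M, th ^+ M <= eps.
Proof.
move=> t0 t1 e0; have h : 0 < 1 - th by rewrite subr_gt0.
pose a := ((1 - th) * eps)^-1; have a0 : 0 < a by rewrite invr_gt0 mulr_gt0.
have [M aM] : exists M : nat, a < M%:R by exists (Num.bound a); apply: archi_boundP; exact: ltW.
exists M; have : M%:R * th ^+ M <= (1 - th)^-1.
  apply: le_trans (geometric_le _ M t0 t1).
  rewrite mulr_natl -[M in _ *+ M]card_ord -sumr_const; apply: ler_sum => i _.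
  by apply: ler_wiXn2l => //; [exact: ltW | exact: ltnW].
move=> Mle; have M0 : 0 < M%:R :> R by apply: lt_trans aM.
rewrite -(ler_pM2l M0); apply: le_trans Mle _.
rewrite -ler_pdivrMr //; apply: le_trans (ltW aM).
by rewrite /a invfM.
Qed.

End RandomPart.

(** * Union bound for sums far from the vertices *)

Section FarSums.
Local Open Scope fset_scope.
Local Open Scope ring_scope.

(** Nearness is asked of the summands rather than of [k]: this bounds their heights at [u] and [v],
    and at the other points of [V] it puts them into [A] directly. *)
Definition near_vertex {D : nat} (V : seq (zpt D)) (b n : nat) (X : {fset zpt D}) k : Prop :=
  exists p x y, [/\ p \in V, x \in X, y \in X, k = x + y &
    (l1 (x - p *+ n) <= b)%N /\ (l1 (y - p *+ n) <= b)%N].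

(** With [p] minimising the distance from [k] to [p *+ (2 * n)], the near case of
    [near_or_progression] would either make [k] near a vertex or contradict minimality, as
    [c > 2 * (B * size V)]. So there is a progression. *)
Lemma far_sum_missing_le {D : nat} (V : seq (zpt D)) (B e M n : nat)
    (Ln E I : {fset zpt D}) (c := (2 * (B * size V)).+1) k :
  V != [::] -> {in V &, forall a b, (l1 (a - b) <= B)%N} ->
  (forall z, z \in Ln <-> scaled V n z) -> (#|` E| <= e)%N ->
  k \in sumset Ln Ln -> ~ near_vertex V (B * (size V * M)) n Ln k ->
  exists2 p, p \in V & exists2 r,
    (c * M + l1 (k - p *+ (2 * n)) <= 4 * c * r + (4 * e * c + c))%N &
  (expn 4 r * #|` [fset A in [fset A in fpowerset (Ln `\` E) | I `<=` A]
                   | ~~ (k \in sumset A A)]|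
   <= expn 3 r * #|` [fset A in fpowerset (Ln `\` E) | I `<=` A]|)%N.
Proof.
move=> V0 VB LnE Ee /in_sumset[x [y [xL yL kxy]]] far.
have i0 : 'I_(size V) by exists 0%N; rewrite lt0n size_eq0.
pose d (p : zpt D) := l1 (k - p *+ (2 * n)).
case: (@arg_minnP _ i0 predT (fun i => d (nth 0 V i)) isT) => i _ imin.
set p := nth 0 V i in imin.
have pmin p' : p' \in V -> (d p <= d p')%N.
  move=> p'V; have pi : (index p' V < size V)%N by rewrite index_mem.
  by have := imin (Ordinal pi) isT; rewrite /= nth_index.
exists p; first exact: mem_nth.
(* [M] makes a failure rare even for the closest far sums; the quotient makes its probability decay
   with the distance. *)
pose m := maxn M ((d p).-1 %/ c).
have dq : (d p <= c * ((d p).-1 %/ c) + c)%N.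
  by have := divn_eq (d p).-1 c; have := ltn_pmod (d p).-1 (ltn0Sn _ : 0 < c)%N; lia.
have qd : ((d p).-1 %/ c * c <= (d p).-1)%N := leq_divM _ _.
have mM : (M <= m)%N := leq_maxl _ _.
have mq : ((d p).-1 %/ c <= m)%N := leq_maxr _ _.
have [[p' p'V [lx ly]]|[t t0 prog]] := near_or_progression V n m x y B V0 VB
    (proj1 (LnE x) xL) (proj1 (LnE y) yL).
  exfalso; have [qM|Mq] := leqP ((d p).-1 %/ c) M.
    have mE : m = M by apply/maxn_idPl.
    by apply: far; exists p', x, y; split=> //; rewrite -mE.
  have mE : m = ((d p).-1 %/ c)%N by apply/maxn_idPr/ltnW.
  have : (d p' <= 2 * (B * (size V * m)))%N.
    have -> : d p' = l1 ((x - p' *+ n) + (y - p' *+ n)).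
      by rewrite /d kxy mul2n -addnn mulrnDr opprD addrACA.
    by apply: leq_trans (l1D _ _) _; lia.
  have := pmin _ p'V; have : (m * c <= (d p).-1)%N by rewrite mE.
  have : (0 < m)%N by rewrite mE; apply: leq_ltn_trans Mq.
  rewrite /c mulnS; set w := (m * (2 * _))%N.
  have -> : (2 * (B * (size V * m)))%N = w by rewrite /w; lia.
  by lia.
have [|r r1 r2] := card_missing_le Ln E I e m x y t Ee t0.
  by move=> j /prog[/LnE -> /LnE ->].
exists r; last by rewrite kxy.
have h1 : (2 * m <= 4 * r + 4 * e)%N by lia.
have h2 : (c * (M + (d p).-1 %/ c) <= c * (4 * r + 4 * e))%N.
  by rewrite leq_mul2l; apply/orP; right; lia.
by rewrite -/(d p); lia.
Qed.

(** The radius [b] is chosen before [n], [E] and [I]; this order matters because the prescribed set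
    [I] will itself depend on [b]. *)
Lemma most_sets_have_far_sums {D : nat} (V : seq (zpt D)) (B e : nat) :
  V != [::] -> {in V &, forall a b, (l1 (a - b) <= B)%N} ->
  exists b, forall n (Ln E I : {fset zpt D}),
  (forall z, z \in Ln <-> scaled V n z) -> (#|` E| <= e)%N ->
  (#|` [fset A in fpowerset (Ln `\` E) | I `<=` A]| <=
   2 * #|` [fset A in [fset A in fpowerset (Ln `\` E) | I `<=` A] |
      `[< forall k, k \in sumset Ln Ln -> ~ near_vertex V b n Ln k ->
          k \in sumset A A >]]|)%N.
Proof.
move=> V0 VB; pose c := (2 * (B * size V)).+1.
(* Chosen so that the Bernoulli inequality gives [th ^+ (4 * c) >= 3 / 4]. *)
pose x : R := (16 * c)%N%:R^-1; pose th := 1 - x.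
have c16 : 0 < (16 * c)%N%:R :> R by rewrite ltr0n muln_gt0.
have x0 : 0 < x by rewrite invr_gt0.
have x1 : x <= 1 by rewrite invf_le1 // ler1n muln_gt0.
have x1' : x < 1 by rewrite invf_lt1 // ltr1n; lia.
have t0 : 0 < th by rewrite subr_gt0.
have t1 : th < 1 by rewrite gtrBl.
have t34 : 3 / 4 <= th ^+ (4 * c).
  apply: le_trans (bernoulli x (4 * c) (ltW x0) x1).
  have -> : (4 * c)%N%:R * x = 1 / 4.
    rewrite /x (_ : 16 * c = 4 * (4 * c))%N; last by lia.
    by rewrite [(4 * (4 * c))%N%:R]natrM invfM mulrCA mulfV ?pnatr_eq0 // mulr1 mul1r.
  lra.
pose C : R := (2 / (1 - th)) ^+ D.
have C0 : 0 < C by rewrite exprn_gt0 // divr_gt0 // subr_gt0.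
have N0 : 0 < (size V)%:R :> R by rewrite ltr0n lt0n size_eq0.
(* [kap] pays for the additive error [4 * e * c + c] of [far_sum_missing_le]; [M] then makes the
   expected number of missed sums at most 1/2. *)
pose kap := th ^+ (4 * e * c + c); have kap0 : 0 < kap by rewrite exprn_gt0.
have [M hM] := expr_small th (kap / (2 * ((size V)%:R * C))) (ltW t0) t1
  (divr_gt0 kap0 (mulr_gt0 (ltr0Sn _ 1) (mulr_gt0 N0 C0))).
exists (B * (size V * M))%N => n Ln E I LnE Ee.
set F0 := [fset A in fpowerset (Ln `\` E) | I `<=` A].
pose K := [seq k <- sumset Ln Ln | ~~ `[< near_vertex V (B * (size V * M)) n Ln k >]].
have uK : uniq K by rewrite filter_uniq // fset_uniq.
have KP k : k \in K -> k \in sumset Ln Ln /\ ~ near_vertex V (B * (size V * M)) n Ln k.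
  by rewrite mem_filter => /andP[/asboolPn].
set G := [fset A in F0 | `[< _ >]].
have ub := card_union_bound F0 K (fun k A => k \in sumset A A).
have GE : [fset A in F0 | all ((fun k A => k \in sumset A A)^~ A) K] `<=` G.
  apply/fsubsetP => A; rewrite !inE /= => /andP[-> /allP h] /=.
  apply/asboolP => k kL kfar; apply: h; rewrite mem_filter kL andbT.
  exact/asboolPn.
have {}ub := leq_trans ub (leq_add (fsubset_leq_card GE) (leqnn _)).
set S := (\sum_(k <- K) _)%N in ub.
suff S2 : (2 * S <= #|` F0|)%N.
  by move: ub S2; clear; move: S #|` F0| #|` G| => a b1 g; lia.
have kM0 : 0 <= kap^-1 * th ^+ M by rewrite mulr_ge0 // ?invr_ge0 ?exprn_ge0 // ltW.
(* The nearest [p] depends on [k]; bounding its term by the sum over [V] allows the two sums to be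
   exchanged. *)
have SK k : k \in K -> #|` [fset A in F0 | ~~ (k \in sumset A A)]|%:R <=
    #|` F0|%:R * (kap^-1 * th ^+ M) * \sum_(p <- V) th ^+ l1 (k - p *+ (2 * n)) :> R.
  move=> /KP[kL kfar].
  have [p pV [r r1 r2]] := far_sum_missing_le V B e M n Ln E I k V0 VB LnE Ee kL kfar.
  apply: le_trans (_ : #|` F0|%:R * (kap^-1 * th ^+ M) * th ^+ l1 (k - p *+ (2 * n)) <= _).
    rewrite -mulrA; apply: le_trans (_ : #|` F0|%:R * (3 / 4) ^+ r <= _).
      rewrite expr_div_n mulrA ler_pdivlMr ?exprn_gt0 //.
      by rewrite -!natrX -!natrM ler_nat mulnC [leqRHS]mulnC.
    rewrite ler_wpM2l // -mulrA ler_pdivlMl //.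
    apply: le_trans (_ : kap * th ^+ (4 * c * r) <= _).
      rewrite ler_wpM2l ?(ltW kap0) // exprM; apply: lerXn2r => //.
      - by rewrite nnegrE divr_ge0.
      - by rewrite nnegrE exprn_ge0 // ltW.
    rewrite -!exprD; apply: ler_wiXn2l; [exact: ltW|exact: ltW|].
    by rewrite [leqRHS]addnC; apply: leq_trans r1; rewrite leq_add2r leq_pmull.
  apply: ler_wpM2l; first by rewrite mulr_ge0 // kM0.
  rewrite (big_rem p) //= lerDl; apply: sumr_ge0 => q _; rewrite exprn_ge0 //.
  exact: ltW.
rewrite -(ler_nat R) natrM /S natr_sum.
apply: le_trans (_ : 2 * (\sum_(k <- K) #|` F0|%:R * (kap^-1 * th ^+ M) *
     \sum_(p <- V) th ^+ l1 (k - p *+ (2 * n))) <= _).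
  by rewrite ler_pM2l // big_seq [leRHS]big_seq; apply: ler_sum.
rewrite -mulr_sumr exchange_big /=.
have inner p : \sum_(k <- K) th ^+ l1 (k - p *+ (2 * n)) <= C.
  rewrite -(big_map (fun k => k - p *+ (2 * n)) predT (fun z => th ^+ l1 z)).
  apply: sum_expr_l1_le => //; last exact: ltW.
  by rewrite map_inj_uniq //; apply: addIr.
apply: le_trans (_ : 2 * (#|` F0|%:R * (kap^-1 * th ^+ M) * ((size V)%:R * C)) <= _).
  rewrite ler_pM2l //; apply: ler_wpM2l; first by rewrite mulr_ge0.
  apply: le_trans (_ : \sum_(p <- V) C <= _); first by apply: ler_sum.
  by rewrite big_const_seq count_predT iter_addr_0 mulr_natl.
have h : kap^-1 * th ^+ M * (2 * ((size V)%:R * C)) <= 1.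
  rewrite -mulrA mulrC -ler_pdivlMr ?invr_gt0 // invrK mul1r.
  by rewrite -ler_pdivlMr // !mulr_gt0.
rewrite -[leRHS]mulr1 mulrCA -mulrA ler_wpM2l //.
Qed.

End FarSums.

(** * Finite dilates and intervals of subsets *)

Lemma dilate_finite {D : nat} (V : seq (zpt D)) n : V != [::] ->
  exists Ln : {fset zpt D}, forall z, z \in Ln <-> scaled V n z.
Proof.
move=> V0; pose B := (\sum_(a <- V) \sum_(b <- V) l1 (a - b)%R)%N.
have VB : {in V &, forall a b, (l1 (a - b) <= B)%N}.
  move=> a b aV bV; rewrite /B (big_rem a) //= (big_rem b) //= -addnA.
  exact: leq_addr.
have p0 : nth 0 V 0 \in V by rewrite mem_nth // lt0n size_eq0.
set p := nth 0 V 0 in p0.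
have [X hX] := @l1_ball_finite D (B * n).
exists (seq_fset tt [seq z <- [seq x + p *+ n | x <- X] | `[< scaled V n z >]]) => z.
rewrite seq_fsetE mem_filter; split=> [/andP[/asboolP]//|zn].
apply/andP; split; first exact/asboolP.
apply/mapP; exists (z - p *+ n); last by rewrite subrK.
apply: hX; case: (zn) => lam [l0 ls hz].
apply: (scaled_near_l1 _ _ _ _ lam) => //; rewrite -ls.
by rewrite [leRHS](bigID (fun i : 'I_(size V) => nth 0 V i != p)) /= lerDl sumr_ge0.
Qed.

Section Cardinals.
Local Open Scope fset_scope.

Lemma card_fset_le_seq {T : choiceType} (X : {fset T}) (l : seq T) :
  {subset X <= l} -> (#|` X| <= size l)%N.
Proof. by move=> h; apply: uniq_leq_size => //; apply: fset_uniq. Qed.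

Lemma card_interval_fset {T : choiceType} (I H : {fset T}) : I `<=` H ->
  (expn 2 #|` H `\` I| <= #|` [fset A in fpowerset H | I `<=` A]%fset| )%N.
Proof.
move=> IH; rewrite -card_fpowerset.
have <- : #|` [fset A `|` I | A in fpowerset (H `\` I)]| = #|` fpowerset (H `\` I)|.
  apply: card_in_imfset => A B /=; rewrite !fpowersetE !fsubsetD.
  move=> /andP[_ dA] /andP[_ dB] e.
  have h X : [disjoint X & I] -> (X `|` I) `\` I = X.
    by move=> dX; rewrite fsetDUl fsetDv fsetU0; apply/fsetDidPl.
  by rewrite -(h A dA) -(h B dB) e.
apply/fsubset_leq_card/fsubsetP => B /imfsetP[A /=]; rewrite fpowersetE fsubsetD.
move=> /andP[AH _] ->; rewrite !inE /= fpowersetE fsubUset AH IH.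
exact: fsubsetUr.
Qed.

End Cardinals.

(** * Assembling the fringes and the random middle *)

Local Open Scope fset_scope.
Local Open Scope ring_scope.

Lemma subset_A_fringe {D : nat} (Ln E A : {fset zpt D}) (P : zpt D -> Prop) :
  A `<=` Ln `\` E -> (forall z, z \in E <-> z \in Ln /\ ~ P z) ->
  forall z, z \in A -> z \in Ln /\ P z.
Proof.
move=> AH EP z /(fsubsetP AH) /fsetDP[zL zE]; split=> //.
by apply: contrapT => nP; move/negP: zE; apply; apply/EP.
Qed.

Lemma doubleB {D : nat} (p x y : zpt D) n :
  p *+ (2 * n) - (x + y) = (p *+ n - x) + (p *+ n - y).
Proof. by rewrite mul2n -addnn mulrnDr opprD addrACA. Qed.

Theorem theorem2 (D : nat) (V : seq 'rV[int]_D)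
    (hV : exists2 u, u \in V & exists2 v, v \in V & u != v)
    (s d : nat) :
  exists c : R, 0 < c /\
  exists N : nat, forall n : nat, leq N n ->
    exists Ln : {fset 'rV[int]_D},
      (forall z, z \in Ln <-> in_dil V n z) /\
      c * 2 ^+ #|` Ln| <=
        (#|` [fset A in fpowerset Ln |
               eqn #|` sumset Ln Ln `\` sumset A A| s &&
               leq (muln 2 d) #|` diffset Ln Ln `\` diffset A A|] |)%:R.
Proof.
have V0 : V != [::] by case: hV => u uV _; case: V uV.
have [f [u [v [uV vV fuv fu fv]]]] := exists_extreme_pair V hV.
(* The cone at [u] is reflected, so that [f] is positive on both cones and both contain [w]; a point
   [z] is seen as [u *+ n - z] in the first and as [z - v *+ n] in the second. *)
pose e1 (i : 'I_(size V)) := - (nth 0 V i - u).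
pose e2 (i : 'I_(size V)) := nth 0 V i - v.
pose w := u - v; have fw : f w = f u - f v by rewrite raddfB.
have w0 : 0 < f w by rewrite fw subr_gt0.
have fe1 i : e1 i != 0 -> 0 < f (e1 i).
  rewrite /e1 oppr_eq0 subr_eq0 opprB raddfB subr_gt0; apply: fu.
  exact: mem_nth.
have fe2 i : e2 i != 0 -> 0 < f (e2 i).
  rewrite /e2 subr_eq0 raddfB subr_gt0; apply: fv; exact: mem_nth.
have [H1 H10 gs1] := cone_graded f e1 fe1.
have [H2 H20 gs2] := cone_graded f e2 fe2.
have K1w : cone e1 w.
  have vi : (index v V < size V)%N by rewrite index_mem.
  have := cone_mem e1 (Ordinal vi) 1.
  by rewrite mulr1n /e1 /= nth_index // opprB.
have K2w : cone e2 w.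
  have ui : (index u V < size V)%N by rewrite index_mem.
  by have := cone_mem e2 (Ordinal ui) 1; rewrite mulr1n /e2 /= nth_index.
have [t [R [L [U [cs [[uR sR RK LLR hLL] hUU [LK hL] [UK hU] [ucs scs hcs]]]]]]] :=
  fringe f w s d gs1 gs2 H20 K1w K2w w0.
have [t' [tt' Rt]] : exists t' : nat, (t <= t')%N /\ {in R, forall a, f a <= t'%:Z}.
  exists (t + \sum_(a <- R) `|f a|)%N; split=> [|a aR]; first exact: leq_addr.
  apply: le_trans (ler_norm _) _.
  by rewrite -abszE lez_nat (big_rem a) //= addnCA leq_addr.
have {}hL a : cone e1 a -> a \notin R -> t%:Z <= f a -> L a := hL a.
have {}hU a : cone e2 a -> t%:Z <= f a -> U a := hU a.
have hL' a : cone e1 a -> t'%:Z < f a -> L a.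
  move=> Ka fa; apply: hL => //; last by lia.
  by apply/negP => /Rt; rewrite leNgt fa.
have hU' a : cone e2 a -> t'%:Z < f a -> U a.
  by move=> Ka fa; apply: hU => //; lia.
have [X1 hX1] := gs_fin gs1 t'; have [X2 hX2] := gs_fin gs2 t'.
pose e := (size X1 + size X2)%N.
pose B := (\sum_(a <- V) \sum_(b <- V) l1 (a - b)%R)%N.
have VB : {in V &, forall a b, (l1 (a - b) <= B)%N}.
  move=> a b aV bV; rewrite /B (big_rem a) //= (big_rem b) //= -addnA.
  exact: leq_addr.
have e1B i : (l1 (e1 i) <= B)%N by rewrite l1N VB // mem_nth.
have e2B i : (l1 (e2 i) <= B)%N by rewrite VB // mem_nth.
have [b hb] := most_sets_have_far_sums V B e V0 VB.
have [C hC] := additive_l1 f.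
(* [F] bounds the height of a sum of two points within [b] of [u *+ n] or [v *+ n]. The radius [Q]
   covers both the points within [b] and those of height at most [F] in the cones, whose norm is at
   most [B * F]. *)
pose F := (C * (2 * b))%N.
pose Q := (b + B * F)%N.
have [XQ hXQ] := @l1_ball_finite D Q.
pose i0 := (size V * size XQ)%N.
pose cmax := (\sum_(c <- cs) c)%N.
have csmax c : c \in cs -> (c <= cmax)%N.
  by move=> ccs; rewrite /cmax (big_rem c) //= leq_addr.
(* Excluding [E] and prescribing [I] fixes at most [e + i0] elements; the last 1 is for the half
   kept by [most_sets_have_far_sums]. *)
exists ((1 / 2) ^+ (e + i0 + 1)); split; first by rewrite exprn_gt0 // divr_gt0.
(* The two ends must be over [t' + F] apart in height, so that a point of height at most [F] at one
   end satisfies the pattern of the other; the multiples of [w] indexed by [cs] must also fit in the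
   dilate. *)
exists (1 + t' + F + cmax * `|f w|)%N => n.
have unpack a1 a2 a3 k : (1 + a1 + a2 + a3 <= k)%N -> [/\ 0 < k, a1 + a2 < k & a3 < k]%N.
  by clear; move=> h; split; lia.
move=> /unpack[n0 nTF nc].
have [nF nT] : F%:Z <= n%:Z /\ t'%:Z <= n%:Z.
  by rewrite !lez_nat; split; apply: leq_trans (ltnW nTF); rewrite ?leq_addl ?leq_addr.
have nTF' : t'%:Z + F%:Z < n%:Z by rewrite -PoszD ltz_nat.
have [Ln LnE] := dilate_finite V n V0.
exists Ln; split; first by move=> z; rewrite LnE; split=> /in_dil_scaled; apply.
have Ln1 z : z \in Ln -> cone e1 (u *+ n - z).
  move=> /LnE/(scaled_cone V n z u) h; apply: cone_opp.
  by rewrite opprB.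
have Ln2 z : z \in Ln -> cone e2 (z - v *+ n) by move=> /LnE/(scaled_cone V n z v).
have inL1 a : cone e1 a -> f a <= n%:Z -> u *+ n - a \in Ln.
  move=> Ka fa; apply/LnE.
  pose g : {additive zpt D -> int} := (f \o -%R).
  apply: (cone_scaled V g) => //; last by rewrite /g /= opprK.
    move=> z zV zu; rewrite /g /= opprB raddfB subr_gt0; exact: fu.
  have -> : (fun i : 'I_(size V) => nth 0 V i - u) = (fun i => - e1 i).
    by apply/funext => i; rewrite /e1 opprK.
  by apply: cone_opp; rewrite opprK.
have inL2 a : cone e2 a -> f a <= n%:Z -> v *+ n + a \in Ln.
  move=> Ka fa; apply/LnE; apply: (cone_scaled V f) => //.
  by move=> z zV zv; rewrite raddfB subr_gt0; exact: fv.
pose good z := L (u *+ n - z) /\ U (z - v *+ n).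
pose E := [fset z in Ln | ~~ `[< good z >]].
have EP z : z \in E <-> z \in Ln /\ ~ good z.
  by rewrite !inE /=; split=> [/andP[? /asboolPn]|[-> /asboolPn ->]].
(* A point higher than [t'] in both cones is good, so [E] lies in copies of the fixed finite sets
   [X1] and [X2]. *)
have Ee : (#|` E| <= e)%N.
  rewrite -[e](_ : size ([seq u *+ n - a | a <- X1] ++ [seq v *+ n + a | a <- X2]) = _).
    apply: card_fset_le_seq => z /EP[zL ng]; rewrite mem_cat.
    have [h1|h1] := lerP (f (u *+ n - z)) t'%:Z.
      apply/orP; left; apply/mapP; exists (u *+ n - z); last by rewrite subKr.
      exact: hX1 (Ln1 z zL) h1.
    have [h2|h2] := lerP (f (z - v *+ n)) t'%:Z.
      apply/orP; right; apply/mapP; exists (z - v *+ n); last by rewrite addrC subrK.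
      exact: hX2 (Ln2 z zL) h2.
    by case: ng; split; [apply: hL' => //; apply: Ln1 | apply: hU' => //; apply: Ln2].
  by rewrite size_cat !size_map.
pose I := [fset z in Ln `\` E | has (fun p => (l1 (z - p *+ n)%R <= Q)%N) V].
have IH : I `<=` Ln `\` E by apply/fsubsetP => z; rewrite !inE => /andP[].
have Ii : (#|` I| <= i0)%N.
  rewrite -[i0](_ : size [seq x + p *+ n | p <- V, x <- XQ] = _); last by rewrite size_allpairs.
  apply: card_fset_le_seq => z; rewrite !inE /= => /andP[_ /hasP[p pV zp]].
  by apply/allpairsP; exists (p, z - p *+ n); rewrite /= subrK; split=> //; exact: hXQ.
have {hb}hb := hb n Ln E I LnE Ee.
set F0 := [fset A in fpowerset (Ln `\` E) | I `<=` A] in hb.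
set G := [fset A in F0 | _] in hb.
set Fam := [fset A in fpowerset Ln | _].
suff GF : G `<=` Fam.
  have c1 := card_interval_fset I (Ln `\` E) IH.
  have c2 := fsubset_leq_card GF.
  have c3 : (#|` Ln| <= #|` (Ln `\` E) `\` I| + (e + i0))%N.
    rewrite cardfsDS // cardfsDS; last by apply/fsubsetP => z /EP[].
    by move: Ee Ii; clear; move: #|` Ln| #|` E| #|` I| e i0 => *; lia.
  have c4 : (expn 2 #|` Ln| <= expn 2 (e + i0 + 1) * #|` Fam|)%N.
    apply: leq_trans (_ : expn 2 (#|` (Ln `\` E) `\` I| + (e + i0)) <= _)%N.
      by rewrite leq_exp2l.
    rewrite [X in (expn 2 X <= _)%N]addnC expnD [expn 2 (e + i0 + 1)]expnD -mulnA leq_mul2l.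
    apply/orP; right.
    by apply: leq_trans c1 _; apply: leq_trans hb _; rewrite expn1 leq_mul2l c2 orbT.
  rewrite expr_div_n expr1n mul1r -ler_pdivlMl ?invr_gt0 ?exprn_gt0 // invrK.
  by rewrite -!natrX -natrM ler_nat.
apply/fsubsetP => A; rewrite !inE /= => /andP[/andP[AH IA] /asboolP far].
rewrite fpowersetE in AH.
have AP := subset_A_fringe Ln E A good AH EP.
have AL : A `<=` Ln by apply/fsubsetP => z /AP[].
rewrite fpowersetE AL /=.
have f_near x (p : zpt D) : (l1 (x - p *+ n) <= b)%N -> `|f x - n%:Z * f p| <= (C * b)%N%:Z.
  move=> h; have <- : f (x - p *+ n) = f x - n%:Z * f p.
    by rewrite raddfB raddfMn /= -mulr_natl natz.
  by apply: le_trans (hC _) _; rewrite lez_nat leq_mul2l h orbT.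
have CbF : (2 * (C * b) = F)%N by rewrite /F mulnCA.
have fn (p : zpt D) : f (p *+ n) = n%:Z * f p by rewrite raddfMn /= -mulr_natl natz.
have fB (x y : zpt D) : f (x - y) = f x - f y by rewrite raddfB.
have fD (x y : zpt D) : f (x + y) = f x + f y by rewrite raddfD.
have fuvn : n%:Z <= n%:Z * f u - n%:Z * f v.
  by rewrite -mulrBr -fw ler_peMr.
have inA z p : z \in Ln -> good z -> p \in V -> (l1 (z - p *+ n) <= Q)%N -> z \in A.
  move=> zL zg pV zp; apply: (fsubsetP IA); rewrite !inE /= zL andbT.
  apply/andP; split; last by apply/hasP; exists p.
  by apply/negP => /andP[_ /asboolPn].
have BFQ : (B * F <= Q)%N by apply: leq_addl.
have inA1 a : L a -> f a <= F%:Z -> u *+ n - a \in A.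
  move=> La fa; have Ka := LK a La; have fa0 := cone_ge0 f e1 fe1 a Ka.
  have aL : u *+ n - a \in Ln by apply: inL1 => //; apply: le_trans nF.
  apply: (inA _ u) => //.
    split; first by rewrite subKr.
    apply: hU'; first exact: Ln2.
    by rewrite !fB !fn; move: fuvn fa nTF'; clear; lia.
  rewrite addrAC subrr sub0r l1N; apply: leq_trans BFQ.
  have := cone_l1_le f e1 fe1 B a e1B Ka; rewrite -lez_nat PoszM => h.
  by apply: le_trans h _; rewrite ler_wpM2l.
have inA2 a : U a -> f a <= F%:Z -> v *+ n + a \in A.
  move=> Ua fa; have Ka := UK a Ua; have fa0 := cone_ge0 f e2 fe2 a Ka.
  have aL : v *+ n + a \in Ln by apply: inL2 => //; apply: le_trans nF.
  apply: (inA _ v) => //.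
    split; last by rewrite addrAC subrr add0r.
    apply: hL'; first exact: Ln1.
    by rewrite fB fD !fn; move: fuvn fa nTF'; clear; lia.
  rewrite addrAC subrr add0r; apply: leq_trans BFQ.
  have := cone_l1_le f e2 fe2 B a e2B Ka; rewrite -lez_nat PoszM => h.
  by apply: le_trans h _; rewrite ler_wpM2l.
apply/andP; split.
- rewrite -[s]sR; apply/eqnP.
  pose M := seq_fset tt [seq u *+ (2 * n) - a | a <- R].
  have <- : #|` M| = size R.
    rewrite size_seq_fset undup_id ?size_map // map_inj_uniq //.
    by move=> x y /addrI/oppr_inj.
  congr (#|` _|); apply/fsetP => k; rewrite seq_fsetE in_fsetD.
  apply/andP/mapP => [[kA kL]|[a aR ->]].
    have : near_vertex V b n Ln k.
      by apply: contrapT => nk; have := far k kL nk; apply/negP.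
    move=> [p [x [y [pV xL yL kxy [xp yp]]]]].
    have fx := f_near x p xp; have fy := f_near y p yp.
    (* At [u], a cone point outside [R] splits into two elements of [L] of height at most [F], whose
       points in the dilate are prescribed. At [v] the same works with [U] and no exception. *)
    have [pu|pu] := eqVneq p u.
      exists (u *+ (2 * n) - k); last by rewrite subKr.
      apply/negPn/negP => aR; move/negP: kA; apply.
      have ak : u *+ (2 * n) - k = (u *+ n - x) + (u *+ n - y).
        by rewrite kxy doubleB.
      have [a1 [a2 [La1 La2 a12]]] :=
        hLL _ (eq_ind_r (cone e1) (gsD gs1 (Ln1 x xL) (Ln1 y yL)) ak) aR.
      have g1 := cone_ge0 f e1 fe1 _ (LK _ La1).
      have g2 := cone_ge0 f e1 fe1 _ (LK _ La2).
      have fa : f a1 + f a2 <= F%:Z.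
        rewrite -fD -a12 ak fD !fB !fn -pu; move: fx fy CbF; clear; lia.
      apply/in_sumset; exists (u *+ n - a1), (u *+ n - a2).
      split; [by apply: inA1 => //; move: fa g2; clear; lia | by apply: inA1 => //; move: fa g1; clear; lia |].
      by rewrite -doubleB -a12 subKr.
    have [pv|pv] := eqVneq p v.
      exfalso; move/negP: kA; apply.
      have ak : k - v *+ (2 * n) = (x - v *+ n) + (y - v *+ n).
        by rewrite kxy -[LHS]opprB doubleB opprD !opprB.
      have [a1 [a2 [La1 La2 a12]]] :=
        hUU _ (eq_ind_r (cone e2) (gsD gs2 (Ln2 x xL) (Ln2 y yL)) ak).
      have g1 := cone_ge0 f e2 fe2 _ (UK _ La1).
      have g2 := cone_ge0 f e2 fe2 _ (UK _ La2).
      have fa : f a1 + f a2 <= F%:Z.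
        rewrite -fD -a12 ak fD !fB !fn -pv; move: fx fy CbF; clear; lia.
      apply/in_sumset; exists (v *+ n + a1), (v *+ n + a2).
      split; [by apply: inA2 => //; move: fa g2; clear; lia | by apply: inA2 => //; move: fa g1; clear; lia |].
      by rewrite addrACA -a12 -mulrnDr addnn -mul2n addrC subrK.
    (* Here [f p] lies strictly between [f v] and [f u], so lattice points of the dilate near
       [p *+ n] are high in both cones, hence good and prescribed. *)
    exfalso; move/negP: kA; apply.
    have up : n%:Z <= n%:Z * f u - n%:Z * f p.
      by rewrite -mulrBr ler_peMr //; have := fu p pV pu; clear; lia.
    have pvn : n%:Z <= n%:Z * f p - n%:Z * f v.
      by rewrite -mulrBr ler_peMr //; have := fv p pV pv; clear; lia.
    have zA z : z \in Ln -> (l1 (z - p *+ n) <= b)%N -> z \in A.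
      move=> zL zp; have fz := f_near z p zp.
      apply: (inA z p) => //; last by apply: leq_trans zp _; apply: leq_addr.
      split; [apply: hL'; first exact: Ln1 | apply: hU'; first exact: Ln2].
        by rewrite fB fn; move: fz up nTF' CbF; clear; lia.
      by rewrite fB fn; move: fz pvn nTF' CbF; clear; lia.
    by apply/in_sumset; exists x, y; split=> //; apply: zA.
  (* Conversely, elements of [A] follow [L] at [u], and [L + L] avoids [R]. *)
  have Ka := RK a aR; split.
    apply/in_sumset => -[x [y [/AP[_ [Lx _]] /AP[_ [Ly _]] axy]]].
    by have := LLR _ _ Lx Ly; rewrite -doubleB -axy subKr aR.
  apply/in_sumset; exists (u *+ n), (u *+ n - a); split.
  - by rewrite -[u *+ n]subr0; apply: inL1; [exact: (gs0 gs1) | rewrite raddf0].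
  - by apply: inL1 => //; apply: le_trans nT; apply: Rt.
  - by rewrite mul2n -addnn mulrnDr addrA.
have fwc c : c \in cs -> c%:Z * f w <= n%:Z.
  move=> /csmax cc; apply: le_trans (_ : (cmax * `|f w|)%N%:Z <= _); last by rewrite lez_nat ltnW.
  by rewrite PoszM abszE (gtr0_norm w0) ler_pM2r.
have cn c : c \in cs -> (c < n)%N.
  move=> /csmax cc; apply: leq_ltn_trans cc _; apply: leq_ltn_trans (_ : cmax * `|f w| < n)%N.
    by rewrite leq_pmulr // absz_gt0 gt_eqF.
  exact: nc.
have diffN1 (X : {fset zpt D}) z : z \in diffset X X -> - z \in diffset X X.
  by move=> /in_diffset[x [y [xX yX ->]]]; apply/in_diffset; exists y, x; rewrite opprB.
have diffN (X : {fset zpt D}) z : (- z \in diffset X X) = (z \in diffset X X).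
  by apply/idP/idP => /diffN1; rewrite ?opprK.
(* If [dl c = x - y], then [x] seen from [u] and [y] seen from [v] add up to [w *+ c], which [hcs]
   forbids for elements of [A]. *)
pose dl c := w *+ (n - c).
have dlE c : c \in cs -> dl c = (u *+ n - w *+ c) - v *+ n.
  by move=> /cn/ltnW cn'; rewrite /dl mulrnBr // mulrnBl addrAC.
have dlin c : c \in cs -> dl c \in diffset Ln Ln `\` diffset A A.
  move=> ccs; rewrite in_fsetD; apply/andP; split; last first.
    apply/in_diffset; exists (u *+ n - w *+ c), (v *+ n); rewrite dlE //; split=> //.
      apply: inL1; first exact: (gs_mulrn f gs1).
      by rewrite raddfMn /= -mulr_natl natz fwc.
    by rewrite -[v *+ n]addr0; apply: inL2; [exact: (gs0 gs2) | rewrite raddf0].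
  apply/in_diffset => -[x [y [/AP[_ [Lx _]] /AP[_ [_ Uy]]]]].
  rewrite dlE // => dxy; apply: (hcs c ccs _ _ Lx Uy).
  have -> : (u *+ n - x) + (y - v *+ n) = u *+ n - v *+ n - (x - y).
    by rewrite opprB addrACA [RHS]addrACA [- x - _]addrC.
  by rewrite -dxy [u *+ n - w *+ c - _]addrAC subKr.
(* Difference sets are symmetric, and all [dl c] have positive height, so the negatives give [d]
   further missing differences. *)
pose l := [seq dl c | c <- cs] ++ [seq - dl c | c <- cs].
have fdl c : c \in cs -> 0 < f (dl c).
  move=> /cn cn'; rewrite /dl raddfMn /= -mulr_natl natz mulr_gt0 // ltz_nat.
  by rewrite subn_gt0.
have dlinj : {in cs &, injective dl}.
  have wn0 : w != 0 by apply: contraTneq w0 => ->; rewrite raddf0.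
  move=> c c' /cn cn1 /cn cn2 /(mulrn_inj w wn0).
  by move: cn1 cn2; clear; lia.
rewrite -[leq _ _]/(_ <= _)%N -scs mul2n -addnn.
have -> : (size cs + size cs = size l)%N by rewrite size_cat !size_map.
apply: uniq_leq_size.
  rewrite cat_uniq !map_inj_in_uniq ?ucs ?andbT //=; last first.
    by move=> c c' h h' /oppr_inj; apply: dlinj.
  apply/hasPn => z /mapP[c ccs ->]; apply/mapP => -[c' ccs' dd].
  by have := fdl c' ccs'; rewrite -dd raddfN oppr_gt0 ltNge ltW // fdl.
move=> z; rewrite mem_cat => /orP[] /mapP[c /dlin cin ->] //.
by move: cin; rewrite !in_fsetD !diffN.
Qed.
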